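(* Let $X$ be a Banach space. Assume that there exist seminormalized basic sequences $(x_i)$, $(y_i)$ in $X$ and some $p\in[1,\infty)$ such that $(x_i)$ has a spreading model $(\tilde x_i)$ which is s.c. dominated by the unit vector basis of $\ell_p$, and $(y_i)$ has a spreading model $(\tilde y_i)$ such that $p$ belongs to the Krivine set of $(\tilde y_i)$. Then there exist a closed subspace $Y$ of $X$ with a basis and a bounded linear operator $T:Y\to X$ which is not a compact perturbation of a multiple of the inclusion map, i.e. there is no scalar $\lambda$ such that $T-\lambda i_{Y\to X}$ is compact, where $i_{Y\to X}$ is the inclusion map.
   Context: Spreading model: a seminormalized basic sequence $(x_n)$ in a Banach space has spreading model $(\tilde x_n)$, a seminormalized basic sequence in some (possibly different) Banach space, if there is a sequence $\varepsilon_n\searrow0$ such that for all $n\in\mathbb{N}$, all scalars $(a_i)_{i=1}^n$ with $|a_i|\le1$, and all $n\le k_1<\dots<k_n$, $\left|\,\|\sum_{i=1}^n a_ix_{k_i}\|-\|\sum_{i=1}^n a_i\tilde x_i\|\,\right|<\varepsilon_n$. Domination on small coefficients: $c_{00}$ is the space of finitely supported scalar sequences. For seminormalized basic sequences $(x_n)$, $(z_n)$ (not necessarily in the same Banach space) and $\varepsilon>0$ let $\Delta_{(z_n),(x_n)}(\varepsilon)=\sup\{\|\sum a_ix_i\|:(a_i)\in c_{00},\ |a_i|\le\varepsilon\text{ for all }i,\ \|\sum a_iz_i\|\le1\}$. One says $(z_n)$ s.c. dominates $(x_n)$ (written $(x_n)<<(z_n)$) if $\lim_{\varepsilon\searrow0}\Delta_{(z_n),(x_n)}(\varepsilon)=0$.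 Krivine set: a basic sequence is $1$-subsymmetric if it is $1$-equivalent to all of its subsequences (spreading models have this property). The Krivine set of a $1$-subsymmetric basic sequence $(x_n)$ is the set of all $p\in[1,\infty]$ such that for all $\varepsilon>0$ and $N\in\mathbb{N}$ there exist $m\in\mathbb{N}$ and scalars $(\lambda_k)_{k=1}^m$ such that for all scalars $(a_n)_{n=1}^N$, $\frac1{1+\varepsilon}\|(a_n)_{n=1}^N\|_p\le\|\sum_{n=1}^N a_ny_n\|\le(1+\varepsilon)\|(a_n)_{n=1}^N\|_p$, where $y_n=\sum_{k=1}^m\lambda_kx_{(n-1)m+k}$ for $n=1,\dots,N$ and $\|\cdot\|_p$ is the norm of $\ell_p$. *)

(* Defs.v *)
From mathcomp Require Export all_boot all_order all_algebra.
From mathcomp Require Export all_classical all_reals all_analysis.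
From mathcomp Require Export complex.

Set Implicit Arguments.
Unset Strict Implicit.
Unset Printing Implicit Defensive.

Export numFieldNormedType.Exports.
Import Order.TTheory GRing.Theory Num.Theory.

Local Open Scope classical_set_scope.
Local Open Scope ring_scope.
Local Open Scope complex_scope.

(* Banach spaces are real (cplx = false) or complex (cplx = true). *)
Definition scalars (R : realType) (cplx : bool) : numFieldType :=
  if cplx then (R[i] : numFieldType) else (R : numFieldType).

Definition scalar_re (R : realType) (cplx : bool) : scalars R cplx -> R :=
  match cplx with true => fun z : R[i] => complex.Re z | false => fun z => z end.

(* The library norm takes values in the field of scalars, hence in R[i] for a
   complex space; [rnorm] is the same (real) number as an element of R. *)
Definition rnorm (R : realType) (cplx : bool)
    (V : normedZmodType (scalars R cplx)) (v : V) : R :=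
  scalar_re `|v|.

Section Banach.
Context {R : realType} {cplx : bool}.
Local Notation K := (scalars R cplx).

Definition closed_span (X : normedModType K) (x : nat -> X) : set X :=
  closure [set v | exists (n : nat) (a : 'I_n -> K), v = \sum_(i < n) a i *: x i].

Definition schauder_basis (X : normedModType K) (Y : set X) (e : nat -> X) :=
  (forall i, Y (e i)) /\
  forall v, Y v ->
    exists! a : nat -> K, series (fun i => a i *: e i) @ \oo --> v.

Definition basic_sequence (X : normedModType K) (x : nat -> X) :=
  schauder_basis (closed_span x) x.

Definition seminormalized (X : normedModType K) (x : nat -> X) :=
  exists c C : R, 0 < c /\ forall i, c <= rnorm (x i) <= C.

(* Sequences are indexed from 0 and [eps n] bounds the combinations of n.+1
   vectors; so the textbook constraint n+1 <= k_1 < ... < k_(n+1) on 1-based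
   indices becomes n <= k 0 < ... < k n. *)
Definition spreading_model (X E : normedModType K)
    (x : nat -> X) (xt : nat -> E) :=
  [/\ seminormalized xt, basic_sequence xt &
   exists eps : nat -> R,
   [/\ nonincreasing_seq eps, eps @ \oo --> (0 : R) &
    forall (n : nat) (a : 'I_n.+1 -> K) (k : 'I_n.+1 -> nat),
      (forall i, rnorm (a i) <= 1) ->
      (n <= k ord0)%N -> (forall i j : 'I_n.+1, (i < j)%N -> (k i < k j)%N) ->
      `| rnorm (\sum_i a i *: x (k i)) - rnorm (\sum_i a i *: xt i) | < eps n]].

(* An element of c_00 is given by finitely many coefficients, and a basic
   sequence z enters s.c. domination only through the norm
   a |-> || sum_i a_i z_i || which it induces on c_00. *)
Definition c00_norm := forall n : nat, ('I_n -> K) -> R.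

Definition seq_norm (X : normedModType K) (x : nat -> X) : c00_norm :=
  fun n a => rnorm (\sum_(i < n) a i *: x i).

(* the norm induced on c_00 by the unit vector basis of l_p, 1 <= p <= +oo *)
Definition lp_norm (p : \bar R) : c00_norm := fun n a =>
  match p with
  | r%:E%E => (\sum_(i < n) rnorm (a i) `^ r) `^ r^-1
  | +oo%E => \big[Num.max/0]_(i < n) rnorm (a i)
  | -oo%E => 0
  end.

Definition sc_Delta (nz nx : c00_norm) (eps : R) : \bar R :=
  ereal_sup [set t : \bar R | exists (n : nat) (a : 'I_n -> K),
    [/\ forall i, rnorm (a i) <= eps, nz n a <= 1 & t = (nx n a)%:E%E]].

(* nz and nx are the norms induced by the dominating and the dominated sequence *)
Definition sc_dominates (nz nx : c00_norm) :=
  sc_Delta nz nx eps @[eps --> (0 : R)^'+] --> (0 : \bar R)%E.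

(* The y_n of the definition is, with 0-based indices,
   sum_(k < m) lambda_k x_(n m + k). *)
Definition krivine_set (X : normedModType K) (x : nat -> X) : set (\bar R) :=
  [set p : \bar R | (1 <= p)%E /\
    forall (eps : R) (N : nat), 0 < eps ->
    exists (m : nat) (lambda : 'I_m -> K), forall a : 'I_N -> K,
      let y (n : nat) := \sum_(k < m) lambda k *: x (n * m + k)%N in
      (1 + eps)^-1 * lp_norm p a <= rnorm (\sum_(n < N) a n *: y n)
        <= (1 + eps) * lp_norm p a].

Definition closed_subspace (X : normedModType K) (Y : set X) :=
  [/\ closed Y, Y 0 & forall (a : K) u v, Y u -> Y v -> Y (a *: u + v)].

(* An operator Y -> X is encoded as a function X -> X of which only the values
   on Y matter. *)
Definition bounded_operator_on (X : normedModType K) (Y : set X) (T : X -> X) :=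
  (forall (a : K) u v, Y u -> Y v -> T (a *: u + v) = a *: T u + T v) /\
  exists C : R, forall v, Y v -> rnorm (T v) <= C * rnorm v.

Definition compact_operator_on (X : normedModType K) (Y : set X) (T : X -> X) :=
  precompact (T @` [set v | Y v /\ rnorm v <= 1]).

End Banach.

(* Main.v *)
Require Import Defs.
From mathcomp Require Import ring lra zify.

(** The operator T sends a basic sequence z_0, z_1, ... built from the y_n to
    the vectors x_(k_i) for even i, and to 0 for odd i. Such a T cannot be a
    multiple of the inclusion plus a compact operator: on the odd part
    T - lambda is -lambda times a separated bounded sequence, so lambda = 0,
    and on the even part T takes the values x_(k_i), which stay apart because
    the first two vectors of a spreading model are distinct. So everything is
    in the boundedness of T, that is in an estimate of the norm of
    sum_i a_i x_(k_i), i even, by that of sum_i a_i z_i.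

    Normalize so that all |a_i| <= 1 and split the indices into the levels
    delta_(j+1) < |a_i| <= delta_j. Suppose that the l_p norm of (a_i) on any
    N_j indices i >= j is at most 2^j, where N_j is so large that N_j
    coefficients of size delta_(j+1) would violate this bound. Then the part of
    level j beyond j has at most N_j elements, so for fast growing k_i the
    spreading model (xt_i) computes its norm, and s.c. domination makes it at
    most 2^-j once delta_j is small enough; the at most j other indices of the
    level cost j delta_j. Summing over j bounds T ([upper_estimate]).

    So z has to satisfy: 2^-j times the l_p norm of (a_i) on A is at most a
    constant times the norm of sum_i a_i z_i, whenever A has at most N_j
    elements, all of them >= j ([block_sum_bound]). The Krivine property gives
    for each j a finite sequence of coefficients V_j, N_j successive copies of
    which along (yt_i) span a copy of l_p^(N_j) ([krivine_block]); ideally z_i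
    is the concatenation of V_0, ..., V_i, with V_j weighted by 2^-j. The
    estimate asks to remove from sum_i a_i z_i all indices outside A and all
    levels other than j, and the y_n need not be unconditional in any sense.

    Unconditionality is recovered in the limit. Let [iter_norm x s] be the
    iterated limit along an ultrafilter of the norms of x + sum_k s_k y_(n_k).
    This adjoins to X a sequence which is spreading over X, and averaging two
    copies shows that a difference of two consecutive copies of a block can be
    removed from such a virtual vector without increasing the norm
    ([droppable_diff]); the V_j are taken of this form. The z_i are picked one
    after the other, so generic that exchanging z_i for its virtual version
    changes the norm of a combination of z_0, ..., z_i followed by at most N_j
    virtual blocks V_j by at most 2^-(i+2) ([realizing_sequence]). Now walk down
    from the last index to j: make z_i virtual, then keep V_j from it if i is in
    A and drop it altogether otherwise. Although the sum may be arbitrarily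
    long, at no time are there more than N_j virtual blocks behind the current
    index, and the total error is at most 1 ([extract]). The same step without
    virtual blocks shows that z is basic ([basis_constant]). *)

Set Implicit Arguments.
Unset Strict Implicit.
Unset Printing Implicit Defensive.

Import Order.TTheory GRing.Theory Num.Theory.

Local Open Scope classical_set_scope.
Local Open Scope ring_scope.

(** * Real and complex scalars *)

(** All estimates are made with the real-valued [rnorm]; [of_real] leads back
    to the scalar-valued norm, in the real and the complex case at once. *)
Definition of_real (R : realType) (cplx : bool) (r : R) : scalars R cplx :=
  match cplx return scalars R cplx with true => (r%:C)%C | false => r end.

Section Scalars.
Context {R : realType} {cplx : bool}.
Local Notation K := (scalars R cplx).
Local Notation of_real := (@of_real R cplx).

Lemma of_realK (r : R) : scalar_re (of_real r) = r.
Proof. by rewrite /of_real /scalar_re; case: cplx. Qed.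

Lemma scalar_reK (z : K) : 0 <= z -> of_real (scalar_re z) = z.
Proof.
rewrite /of_real /scalar_re; move: z; case: cplx => //= -[a b].
by rewrite lecE /= => /andP[/eqP -> _].
Qed.

Lemma of_real_le (r s : R) : (of_real r <= of_real s) = (r <= s).
Proof. by rewrite /of_real; case: cplx => //; rewrite lecR. Qed.

Lemma of_real_lt (r s : R) : (of_real r < of_real s) = (r < s).
Proof. by rewrite /of_real; case: cplx => //; rewrite ltcR. Qed.

Lemma of_real0 : of_real 0 = 0. Proof. by rewrite /of_real; case: cplx. Qed.
Lemma of_real1 : of_real 1 = 1. Proof. by rewrite /of_real; case: cplx. Qed.

Lemma of_realD (r s : R) : of_real (r + s) = of_real r + of_real s.
Proof. by rewrite /of_real; case: cplx => //; rewrite rmorphD. Qed.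

Lemma of_realM (r s : R) : of_real (r * s) = of_real r * of_real s.
Proof. by rewrite /of_real; case: cplx => //; rewrite rmorphM. Qed.

Lemma of_real_inj : injective of_real.
Proof. by move=> r s h; rewrite -(of_realK r) h of_realK. Qed.

Lemma normE (V : normedZmodType K) (v : V) : `|v| = of_real (rnorm v).
Proof. by rewrite scalar_reK. Qed.

Lemma rnorm_ge0 (V : normedZmodType K) (v : V) : 0 <= rnorm v.
Proof. by rewrite -of_real_le of_real0 -normE. Qed.

Lemma rnorm0 (V : normedZmodType K) : rnorm (0 : V) = 0.
Proof. by apply: of_real_inj; rewrite -normE normr0 of_real0. Qed.

Lemma rnorm_eq0 (V : normedZmodType K) (v : V) : rnorm v = 0 -> v = 0.
Proof. by move=> h; apply/eqP; rewrite -normr_eq0 normE h of_real0. Qed.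

Lemma rnorm_gt0 (V : normedZmodType K) (v : V) : v != 0 -> 0 < rnorm v.
Proof. by rewrite -of_real_lt of_real0 -normE normr_gt0. Qed.

Lemma rnormD (V : normedZmodType K) (u v : V) :
  rnorm (u + v) <= rnorm u + rnorm v.
Proof. by rewrite -of_real_le of_realD -!normE ler_normD. Qed.

Lemma rnormN (V : normedZmodType K) (v : V) : rnorm (- v) = rnorm v.
Proof. by apply: of_real_inj; rewrite -!normE normrN. Qed.

Lemma rnormBC (V : normedZmodType K) (u v : V) : rnorm (u - v) = rnorm (v - u).
Proof. by rewrite -rnormN opprB. Qed.

Lemma rnormB (V : normedZmodType K) (u v : V) :
  rnorm (u - v) <= rnorm u + rnorm v.
Proof. by rewrite -[rnorm v]rnormN rnormD. Qed.

Lemma rnorm_split (V : normedZmodType K) (v u w : V) :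
  rnorm (u - w) <= rnorm (u - v) + rnorm (v - w).
Proof. by apply: le_trans (rnormD _ _); rewrite addrA subrK. Qed.

Lemma rnorm_le_sub (V : normedZmodType K) (u v : V) :
  rnorm u - rnorm v <= rnorm (u + v).
Proof.
rewrite lerBlDr; have := rnormB (u + v) v.
by rewrite addrK.
Qed.

Lemma rnorm_dist (V : normedZmodType K) (u v : V) :
  `|rnorm u - rnorm v| <= rnorm (u - v).
Proof.
have h1 := rnormD (u - v) v; have h2 := rnormD (v - u) u.
rewrite subrK in h1; rewrite subrK rnormBC in h2.
by rewrite ler_norml; lra.
Qed.

Lemma rnormZ (V : normedModType K) (a : K) (v : V) :
  rnorm (a *: v) = rnorm a * rnorm v.
Proof. by apply: of_real_inj; rewrite of_realM -!normE normrZ. Qed.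

Lemma rnormM (a b : K) : rnorm (a * b) = rnorm a * rnorm b.
Proof. by apply: of_real_inj; rewrite of_realM -!normE normrM. Qed.

Lemma rnorm1 : rnorm (1 : K) = 1.
Proof. by apply: of_real_inj; rewrite -normE normr1 of_real1. Qed.

Lemma rnorm_of_real (r : R) : 0 <= r -> rnorm (of_real r) = r.
Proof.
move=> r0; apply: of_real_inj; rewrite -normE ger0_norm //.
by rewrite -of_real0 of_real_le.
Qed.

Lemma rnorm_sum (V : normedZmodType K) I (s : seq I) (P : pred I) (f : I -> V) :
  rnorm (\sum_(i <- s | P i) f i) <= \sum_(i <- s | P i) rnorm (f i).
Proof.
elim/big_rec2: _ => [|i a v _ h]; first by rewrite rnorm0.
by apply: le_trans (rnormD _ _) _; rewrite lerD2l.
Qed.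

Lemma of_real_pos (e : K) : 0 < e -> exists2 r : R, 0 < r & e = of_real r.
Proof.
move=> e0; have h := scalar_reK (ltW e0).
by exists (scalar_re e); rewrite // -of_real_lt of_real0 h.
Qed.

End Scalars.

(** * Convergence in terms of the real-valued norm *)

Section Convergence.
Context {R : realType} {cplx : bool}.
Local Notation K := (scalars R cplx).

Definition tends_to (V : normedZmodType K) (u : nat -> V) (l : V) :=
  forall e : R, 0 < e -> exists M, forall n, (M <= n)%N -> rnorm (u n - l) <= e.

Lemma tends_to_unique (V : normedZmodType K) (u : nat -> V) (l m : V) :
  tends_to u l -> tends_to u m -> l = m.
Proof.
move=> ul um; apply/eqP; rewrite -subr_eq0; apply/negPn/negP => /rnorm_gt0 d0.
have e0 : 0 < rnorm (l - m) / 3 by rewrite divr_gt0.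
have [M1 h1] := ul _ e0; have [M2 h2] := um _ e0.
have := h1 _ (leq_maxl M1 M2); have := h2 _ (leq_maxr M1 M2).
have := rnorm_split (u (maxn M1 M2)) l m; rewrite (rnormBC l (u _)); lra.
Qed.

Lemma tends_toP (V : normedModType K) (u : nat -> V) (l : V) :
  u @ \oo --> l <-> tends_to u l.
Proof.
split=> [/cvgrPdist_le h e e0|h].
  have e0' : 0 < of_real cplx e by rewrite -(@of_real0 R cplx) of_real_lt.
  have [M _ hM] := h _ e0'; exists M => n Mn.
  by have := hM n Mn; rewrite normE of_real_le rnormBC.
apply/cvgrPdist_le => e /of_real_pos[r r0 ->]; have [M hM] := h _ r0.
by exists M => // n /= Mn; rewrite normE of_real_le rnormBC; exact: hM.
Qed.

Lemma closureP (V : normedModType K) (A : set V) (v : V) :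
  closure A v <-> forall e : R, 0 < e -> exists2 u, A u & rnorm (v - u) <= e.
Proof.
split=> [cA e e0|h B].
  have e0' : 0 < of_real cplx e by rewrite -(@of_real0 R cplx) of_real_lt.
  have [u [Au]] := cA _ (nbhsx_ballx v (of_real cplx e) e0').
  rewrite -ball_normE /ball_ /= normE of_real_lt => /ltW ?; by exists u.
move=> /nbhs_ballP[e /= /of_real_pos[r r0 ->]] hB.
have r2 : 0 < r / 2 by rewrite divr_gt0.
have [u Au hu] := h _ r2; exists u; split => //; apply: hB.
by rewrite -ball_normE /ball_ /= normE of_real_lt; lra.
Qed.

Definition cauchy_seq (V : normedZmodType K) (u : nat -> V) :=
  forall e : R, 0 < e -> exists M, forall m n,
    (M <= m)%N -> (M <= n)%N -> rnorm (u m - u n) <= e.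

Lemma cauchy_tends_to (V : completeNormedModType K) (u : nat -> V) :
  cauchy_seq u -> exists l, tends_to u l.
Proof.
move=> hu; suff /cvg_ex[l /tends_toP ul] : cvg (u @ \oo) by exists l.
apply/cauchy_cvgP/cauchy_ballP => e /of_real_pos[r r0 ->].
have r2 : 0 < r / 2 by rewrite divr_gt0.
have [M hM] := hu _ r2.
exists ([set x | exists2 n, (M <= n)%N & u n = x],
        [set x | exists2 n, (M <= n)%N & u n = x]) => /=.
  by split; exists M => // n /= Mn; exists n.
move=> [_ _] [/= [m Mm <-] [n Mn <-]].
by rewrite -ball_normE /ball_ /= normE of_real_lt; have := hM _ _ Mm Mn; lra.
Qed.

End Convergence.

(** * Completeness and total boundedness of the scalars *)

Lemma rnorm_Re (R : realType) (a : scalars R true) :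
  `|complex.Re (a : R[i])| <= rnorm a.
Proof. by rewrite -(@of_real_le R true) -normE; exact: normc_ge_Re. Qed.

Lemma rnorm_Im (R : realType) (a : scalars R true) :
  `|complex.Im (a : R[i])| <= rnorm a.
Proof.
rewrite -(@of_real_le R true) -normE.
case: a => a b; rewrite normc_def lecR /= -sqrtr_sqr ler_wsqrtr //.
by rewrite lerDr sqr_ge0.
Qed.

Lemma rnorm_le_ReIm (R : realType) (a : scalars R true) :
  rnorm a <= `|complex.Re (a : R[i])| + `|complex.Im (a : R[i])|.
Proof.
rewrite -(@of_real_le R true) -normE.
case: a => a b; rewrite normc_def lecR /=.
rewrite -[leRHS]ger0_norm ?addr_ge0 // -sqrtr_sqr ler_wsqrtr // sqrrD.
rewrite !real_normK ?num_real //.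
by rewrite addrAC lerDl mulrn_wge0 // mulr_ge0.
Qed.

Lemma real_cauchy (R : realType) (u : nat -> R) :
  (forall e : R, 0 < e -> exists M, forall m n,
    (M <= m)%N -> (M <= n)%N -> `|u m - u n| <= e) ->
  exists l, forall e : R, 0 < e -> exists M, forall n, (M <= n)%N ->
    `|u n - l| <= e.
Proof. by move=> /(@cauchy_tends_to R false R). Qed.

Lemma scalar_complete (R : realType) (cplx : bool) (u : nat -> scalars R cplx) :
  cauchy_seq u -> exists l, tends_to u l.
Proof.
case: cplx u => u hu; last exact: real_cauchy.
have [|a ha] := @real_cauchy R (fun n => complex.Re (u n : R[i])).
  move=> e /hu[M hM]; exists M => m n Mm Mn.
  have := le_trans (rnorm_Re _) (hM m n Mm Mn).
  by case: (u m) (u n) => [? ?] [? ?].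
have [|b hb] := @real_cauchy R (fun n => complex.Im (u n : R[i])).
  move=> e /hu[M hM]; exists M => m n Mm Mn.
  have := le_trans (rnorm_Im _) (hM m n Mm Mn).
  by case: (u m) (u n) => [? ?] [? ?].
exists ((a +i* b)%C : scalars R true) => e e0.
have e2 : 0 < e / 2 by rewrite divr_gt0.
have [M1 h1] := ha _ e2; have [M2 h2] := hb _ e2.
exists (maxn M1 M2) => n; rewrite geq_max => /andP[/h1 + /h2].
have := rnorm_le_ReIm (u n - (a +i* b)%C).
case: (u n) => ur ui /=; lra.
Qed.

Lemma real_net (R : realType) (eta : R) : 0 < eta ->
  exists S : seq R, forall a : R, `|a| <= 1 ->
    exists2 b, b \in S & `|a - b| <= eta.
Proof.
move=> eta0.
pose N := Num.bound (2 / eta).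
exists [seq -1 + k%:R * eta | k <- iota 0 N] => a; rewrite ler_norml => /andP[a1 a2].
have q0 : 0 <= (a + 1) / eta by rewrite divr_ge0 ?(ltW eta0) //; lra.
have /andP[h1 h2] := truncn_itv q0.
set k := Num.truncn _ in h1 h2.
exists (-1 + k%:R * eta).
  apply/mapP; exists k => //; rewrite mem_iota /= add0n.
  rewrite -(ltr_nat R); apply: le_lt_trans h1 _.
  have := archi_boundP (divr_ge0 (ler0n R 2) (ltW eta0)).
  apply: le_lt_trans; rewrite ler_pM2r ?invr_gt0 //; lra.
rewrite ler_pdivlMr // in h1; rewrite ltr_pdivrMr // -natr1 mulrDl mul1r in h2.
by rewrite ler_norml; lra.
Qed.

Lemma disc_net (R : realType) (cplx : bool) (eta : R) : 0 < eta ->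
  exists S : seq (scalars R cplx), forall a, rnorm a <= 1 ->
    exists2 b, b \in S & rnorm (a - b) <= eta.
Proof.
case: cplx => eta0; last exact: real_net.
have e2 : 0 < eta / 2 by rewrite divr_gt0.
have [S hS] := real_net e2.
exists [seq (p +i* q)%C | p <- S, q <- S] => a a1.
have [p pS hp] := hS _ (le_trans (rnorm_Re _) a1).
have [q qS hq] := hS _ (le_trans (rnorm_Im _) a1).
exists (p +i* q)%C; first by apply/allpairsP; exists (p, q).
have := rnorm_le_ReIm (a - (p +i* q)%C).
by case: a a1 hp hq => ar ai /= _; lra.
Qed.

(** * Limits along an ultrafilter *)

Section UltraLimit.
Context {R : realType} (U : set_system nat) {UU : UltraFilter U}.

Definition ulim (g : nat -> R) : R :=
  get [set l | forall e, 0 < e -> U [set n | `|g n - l| <= e]].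

Lemma ulimP (g : nat -> R) (B : R) : (forall n, `|g n| <= B) ->
  forall e, 0 < e -> U [set n | `|g n - ulim g| <= e].
Proof.
move=> gB; suff [l hl] : exists l, forall e, 0 < e -> U [set n | `|g n - l| <= e].
  by rewrite /ulim; case: xgetP => [? -> //|/(_ l)].
have [|l [_ hl]] := @segment_compact R (- B) B (g @ U) _.
  apply: (@filterS _ U _ setT); last exact: filterT.
  by move=> n _ /=; rewrite in_itv /= -ler_norml.
exists l => e e0; have [//|Uc] := in_ultra_setVsetC [set n | `|g n - l| <= e] UU.
have /= := hl (~` [set r | `|r - l| <= e]) _ Uc (nbhsx_ballx l e e0).
by case=> r []; rewrite /= -ball_normE /ball_ /= distrC => + /ltW.
Qed.

Lemma ulim_const (g : nat -> R) (a : R) : (forall n, g n = a) -> ulim g = a.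
Proof.
move=> ga; have gB n : `|g n| <= `|a| by rewrite ga.
apply/eqP; rewrite -subr_eq0 -normr_le0; apply/ler_addgt0Pl => e e0.
rewrite addr0; have [n] := filter_ex (ulimP gB e0).
by rewrite /= ga distrC.
Qed.

Lemma ulim_le (g : nat -> R) (B c : R) : (forall n, `|g n| <= B) ->
  (forall n, g n <= c) -> ulim g <= c.
Proof.
move=> gB gc; apply/ler_addgt0Pl => e e0.
have [n /=] := filter_ex (ulimP gB e0).
by rewrite ler_norml; have := gc n; lra.
Qed.

Lemma ulim_ge (g : nat -> R) (B c : R) : (forall n, `|g n| <= B) ->
  (forall n, c <= g n) -> c <= ulim g.
Proof.
move=> gB gc; apply/ler_addgt0Pl => e e0.
have [n /=] := filter_ex (ulimP gB e0).
by rewrite ler_norml; have := gc n; lra.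
Qed.

Lemma ulim_leD (g g1 g2 : nat -> R) (B B1 B2 : R) : (forall n, `|g n| <= B) ->
  (forall n, `|g1 n| <= B1) -> (forall n, `|g2 n| <= B2) ->
  (forall n, g n <= g1 n + g2 n) -> ulim g <= ulim g1 + ulim g2.
Proof.
move=> gB g1B g2B h; apply/ler_addgt0Pl => e e0.
have e3 : 0 < e / 3 by rewrite divr_gt0.
have [n /= [[]]] := filter_ex (filterI (filterI (ulimP gB e3) (ulimP g1B e3))
  (ulimP g2B e3)).
by rewrite /= !ler_norml; have := h n; lra.
Qed.

Lemma ulim_near (g : nat -> R) (B c d : R) : (forall n, `|g n| <= B) ->
  U [set n | `|g n - c| <= d] -> `|ulim g - c| <= d.
Proof.
move=> gB h; apply/ler_addgt0Pl => e e0.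
have [n /= [h1 h2]] := filter_ex (filterI (ulimP gB e0) h).
rewrite distrC in h1; apply: le_trans (ler_distD (g n) _ _) _.
exact: lerD.
Qed.

Lemma ulimZ (g g' : nat -> R) (B B' a : R) : (forall n, `|g n| <= B) ->
  (forall n, `|g' n| <= B') -> 0 <= a -> (forall n, g' n = a * g n) ->
  ulim g' = a * ulim g.
Proof.
move=> gB g'B a0 h; apply/eqP; rewrite -subr_eq0 -normr_le0.
apply/ler_addgt0Pl => e e0; rewrite addr0.
have e1 : 0 < e / (a + 1) by rewrite divr_gt0 // ltr_wpDl.
apply: (@ulim_near _ B') => //; apply: filterS (ulimP gB e1) => n /=.
rewrite h -mulrBr normrM (ger0_norm a0) => hn.
apply: (@le_trans _ _ (a * (e / (a + 1)))); first exact: ler_wpM2l.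
by rewrite mulrA ler_pdivrMr ?ltr_wpDl // mulrC ler_pM2l // lerDl.
Qed.

End UltraLimit.

(** * The iterated norm *)

Lemma half_pow_small (R : realType) (B e : R) : 0 < e ->
  exists k : nat, B * 2^-1 ^+ k <= e.
Proof.
move=> e0; exists (Num.bound (B / e)).
rewrite exprVn ler_pdivrMr ?exprn_gt0 // mulrC -ler_pdivrMr //.
have [B0|B0] := leP 0 B.
  apply: (le_trans (ltW (archi_boundP (divr_ge0 B0 (ltW e0))))).
  by rewrite -natrX ler_nat ltnW // ltn_expl.
apply: (@le_trans _ _ 0); last by rewrite exprn_ge0.
by rewrite pmulr_lle0 ?invr_gt0 // ltW.
Qed.

Section Lists.
Context {R : realType} {cplx : bool}.
Local Notation K := (scalars R cplx).

Definition norm1 (s : seq K) : R := \sum_(c <- s) rnorm c.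
Definition dist1 (s t : seq K) : R := \sum_(q <- zip s t) rnorm (q.1 - q.2).
Definition scale (b : K) (s : seq K) : seq K := [seq b * c | c <- s].
Definition add_seq (s t : seq K) : seq K := [seq q.1 + q.2 | q <- zip s t].

Lemma norm1_ge0 s : 0 <= norm1 s.
Proof. by apply: sumr_ge0 => c _; exact: rnorm_ge0. Qed.

Lemma norm1_cons c s : norm1 (c :: s) = rnorm c + norm1 s.
Proof. by rewrite /norm1 big_cons. Qed.

Lemma dist1_cons c s d t : dist1 (c :: s) (d :: t) = rnorm (c - d) + dist1 s t.
Proof. by rewrite /dist1 /= big_cons. Qed.

Lemma dist1_cat s1 s2 t1 t2 : size s1 = size t1 ->
  dist1 (s1 ++ s2) (t1 ++ t2) = dist1 s1 t1 + dist1 s2 t2.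
Proof. by move=> h; rewrite /dist1 zip_cat // big_cat. Qed.

Lemma d1xx s : dist1 s s = 0.
Proof.
elim: s => [|c s ih]; first by rewrite /dist1 big_nil.
by rewrite dist1_cons ih subrr rnorm0 addr0.
Qed.

Lemma dist1_scale a b s : dist1 (scale a s) (scale b s) = rnorm (a - b) * norm1 s.
Proof.
elim: s => [|c s ih]; first by rewrite /dist1 /norm1 !big_nil mulr0.
by rewrite /= dist1_cons ih norm1_cons -mulrBl rnormM mulrDr.
Qed.

Lemma size_scale b s : size (scale b s) = size s. Proof. exact: size_map. Qed.

Lemma scale_cat b s t : scale b (s ++ t) = scale b s ++ scale b t.
Proof. exact: map_cat. Qed.

Lemma scale_scale a b s : scale a (scale b s) = scale (a * b) s.
Proof. by rewrite /scale -map_comp; apply: eq_map => c /=; rewrite mulrA. Qed.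

Lemma scale1 s : scale 1 s = s.
Proof. by rewrite /scale -[RHS]map_id; apply: eq_map => c; rewrite mul1r. Qed.

Lemma scale0 s : scale 0 s = nseq (size s) 0.
Proof. by elim: s => //= c s ->; rewrite mul0r. Qed.

Lemma add_seq_cat s1 s2 t1 t2 : size s1 = size t1 ->
  add_seq (s1 ++ s2) (t1 ++ t2) = add_seq s1 t1 ++ add_seq s2 t2.
Proof. by move=> h; rewrite /add_seq zip_cat // map_cat. Qed.

Lemma add_seq_scale a b s : add_seq (scale a s) (scale b s) = scale (a + b) s.
Proof. by elim: s => //= c s ih; rewrite /add_seq /= -/(add_seq _ _) ih mulrDl. Qed.

Lemma zaddxx s : add_seq s s = scale (1 + 1) s.
Proof. by rewrite -{1 2}(scale1 s) add_seq_scale. Qed.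

End Lists.

Section VirtualNorm.
Context {R : realType} {cplx : bool}.
Local Notation K := (scalars R cplx).
Context {X : normedModType K} (y : nat -> X) (C : R).
Context (U : set_system nat) {UU : UltraFilter U}.

(** The limit of the norms of x + sum_k s_k y_(n_k), the outermost limit being
    the one in n_0: the norm of x + sum_k s_k e_k for a virtual sequence (e_k)
    adjoined to X. *)
Fixpoint iter_norm (x : X) (s : seq K) : R :=
  if s is c :: s' then ulim U (fun n => iter_norm (x + c *: y n) s') else rnorm x.

Hypothesis yC : forall n, rnorm (y n) <= C.

Let C0 : 0 <= C. Proof. exact: le_trans (rnorm_ge0 _) (yC 0). Qed.

Lemma rnorm_step (x : X) (c : K) n : rnorm (x + c *: y n) <= rnorm x + C * rnorm c.
Proof.
apply: le_trans (rnormD _ _) _; rewrite lerD2l rnormZ mulrC.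
by rewrite ler_wpM2r // rnorm_ge0.
Qed.

Lemma iter_norm_bd x s : `|iter_norm x s| <= rnorm x + C * norm1 s.
Proof.
elim: s x => [|c s ih] x /=.
  by rewrite ger0_norm ?rnorm_ge0 // /norm1 big_nil mulr0 addr0.
have h n : `|iter_norm (x + c *: y n) s| <= rnorm x + C * norm1 (c :: s).
  apply: le_trans (ih _) _; rewrite norm1_cons mulrDr addrA lerD2r.
  exact: rnorm_step.
rewrite ler_norml; apply/andP; split.
  by apply: (ulim_ge h) => n; have := h n; rewrite ler_norml => /andP[].
by apply: (ulim_le h) => n; have := h n; rewrite ler_norml => /andP[].
Qed.

Lemma iter_norm_step_bd x c s n :
  `|iter_norm (x + c *: y n) s| <= rnorm x + C * norm1 (c :: s).
Proof.
apply: le_trans (iter_norm_bd _ _) _; rewrite norm1_cons mulrDr addrA lerD2r.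
exact: rnorm_step.
Qed.

Lemma iter_norm_lip x x' s t : size s = size t ->
  iter_norm x s <= iter_norm x' t + (rnorm (x - x') + C * dist1 s t).
Proof.
elim: s t x x' => [|c s ih] [|d t] //= x x' => [_|[st]].
  rewrite /dist1 big_nil mulr0 addr0 addrC -lerBlDr.
  exact: le_trans (ler_norm _) (rnorm_dist _ _).
set D := rnorm (x - x') + _.
rewrite -[D](@ulim_const R U _ (fun=> D)) //.
apply: (@ulim_leD R U _ _ _ _ _ _ `|D|).
- exact: iter_norm_step_bd.
- exact: iter_norm_step_bd.
- by [].
move=> n; apply: le_trans (ih _ _ (x' + d *: y n) st) _; rewrite lerD2l /D dist1_cons.
rewrite mulrDr addrA lerD2r opprD addrACA -scalerBl; exact: rnorm_step.
Qed.

Lemma iter_norm_tri x x' s t : size s = size t ->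
  iter_norm (x + x') (add_seq s t) <= iter_norm x s + iter_norm x' t.
Proof.
elim: s t x x' => [|c s ih] [|d t] //= x x' => [_|[st]]; first exact: rnormD.
apply: (@ulim_leD R U); [exact: iter_norm_step_bd..|].
by move=> n /=; rewrite scalerDl addrACA; exact: ih.
Qed.

Lemma iter_norm_scale a x s : iter_norm (a *: x) (scale a s) = rnorm a * iter_norm x s.
Proof.
elim: s x => [|c s ih] x /=; first exact: rnormZ.
apply: (@ulimZ R U); [exact: iter_norm_step_bd|exact: iter_norm_step_bd|
  exact: rnorm_ge0|].
by move=> n /=; rewrite -ih scalerDr scalerA.
Qed.

(** A zero coefficient can be skipped: this is what makes the virtual sequence
    spreading over X. *)
Lemma iter_norm_zeros x s1 k s2 :
  iter_norm x (s1 ++ nseq k 0 ++ s2) = iter_norm x (s1 ++ s2).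
Proof.
elim: s1 x => [|c s1 ih] x /=; last by congr ulim; apply: funext => n; rewrite ih.
elim: k => //= k ih; apply: ulim_const => n.
by rewrite scale0r addr0.
Qed.

Lemma iter_norm_double x s : iter_norm (x + x) (add_seq s s) = 2 * iter_norm x s.
Proof.
rewrite zaddxx -[x + x]/(x *+ 2) -scaler_nat (_ : 2%:R = 1 + 1) // iter_norm_scale.
by rewrite -of_real1 -of_realD rnorm_of_real.
Qed.

(** In the sum of the two virtual vectors (c v, - c v, 0) and (0, c v, - c v) the
    middle block cancels, and what is left is, up to a gap, twice the vector on
    the left. Each of the two summands has the norm on the right. *)
Lemma iter_norm_half (x : X) s1 s2 v (c d : K) : c = d + d ->
  iter_norm x (s1 ++ scale d v ++ scale (- d) v ++ s2) <=
  iter_norm x (s1 ++ scale c v ++ scale (- c) v ++ s2).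
Proof.
move=> cd; set q := iter_norm x (_ ++ scale c _ ++ _).
rewrite -(ler_pM2l (x := 2)) // -iter_norm_double !add_seq_cat ?size_scale //.
rewrite !add_seq_scale -opprD -cd.
have e1 : iter_norm x (s1 ++ scale c v ++ scale (- c) v ++ scale 0 v ++ s2) = q.
  by rewrite scale0 [scale c v ++ _]catA [s1 ++ _]catA iter_norm_zeros -!catA.
have e2 : iter_norm x (s1 ++ scale 0 v ++ scale c v ++ scale (- c) v ++ s2) = q.
  by rewrite scale0 iter_norm_zeros.
have := iter_norm_tri (s := s1 ++ scale c v ++ scale (- c) v ++ scale 0 v ++ s2)
  (t := s1 ++ scale 0 v ++ scale c v ++ scale (- c) v ++ s2) x x.
rewrite e1 e2 !size_cat !size_scale => /(_ erefl).
rewrite !add_seq_cat ?size_scale // !add_seq_scale addr0 add0r addNr scale0.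
by rewrite catA iter_norm_zeros -catA mulr_natl mulr2n.
Qed.

(** Suppression of a block, uniformly over X and over whatever surrounds it. *)
Definition droppable (v : seq K) := forall b x s1 s2,
  iter_norm x (s1 ++ s2) <= iter_norm x (s1 ++ scale b v ++ s2).

(** Halving repeatedly, the coefficient of the difference block tends to 0 while
    the norm does not grow; continuity gives the bound in the limit. *)
Lemma droppable_diff v : droppable (v ++ scale (-1) v).
Proof.
move=> b x s1 s2; rewrite scale_cat -catA scale_scale mulrC -scale_scale.
set w := scale b v.
pose g (r : R) := iter_norm x
  (s1 ++ scale (of_real cplx r) w ++ scale (- of_real cplx r) w ++ s2).
have -> : iter_norm x (s1 ++ w ++ scale (-1) w ++ s2) = g 1.
  by rewrite /g of_real1 scale1.
have hg k : g (2^-1 ^+ k) <= g 1.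
  elim: k => [|k ih]; first by rewrite expr0.
  apply: le_trans ih; apply: iter_norm_half; rewrite -of_realD exprS.
  by congr of_real; field.
apply/ler_addgt0Pl => e e0.
have [k hk] := half_pow_small (2 * C * norm1 w) e0.
apply: (@le_trans _ _ (e + g (2^-1 ^+ k))); last by rewrite lerD2l.
set r := 2^-1 ^+ k in hk *.
have -> : iter_norm x (s1 ++ s2) = iter_norm x (s1 ++ scale 0 w ++ scale 0 w ++ s2).
  by rewrite !scale0 iter_norm_zeros iter_norm_zeros.
have sz : size (s1 ++ scale 0 w ++ scale 0 w ++ s2) =
    size (s1 ++ scale (of_real cplx r) w ++ scale (- of_real cplx r) w ++ s2).
  by rewrite !size_cat !size_scale.
have := iter_norm_lip x x sz; rewrite -/(g r) addrC => /le_trans; apply.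
rewrite lerD2r subrr rnorm0 add0r !dist1_cat ?size_scale // !d1xx !dist1_scale.
rewrite !sub0r opprK rnormN rnorm_of_real ?exprn_ge0 // add0r addr0.
by apply: le_trans hk; rewrite le_eqVlt; apply/orP; left; apply/eqP; ring.
Qed.

Lemma droppable_scale a v : droppable v -> droppable (scale a v).
Proof. by move=> h b x s1 s2; rewrite scale_scale; exact: h. Qed.

Lemma droppable_flatten (vs : seq (seq K)) :
  (forall v, v \in vs -> droppable v) -> droppable (flatten vs).
Proof.
move=> + b x s1 s2; elim: vs s1 => [|v vs ih] s1 h //=.
rewrite scale_cat -catA; apply: le_trans (h v (mem_head _ _) b x s1 _).
by apply: ih => w wvs; apply: h; rewrite inE wvs orbT.
Qed.

Lemma iter_norm_cat0 s t : iter_norm 0 (s ++ t) <= iter_norm 0 s + iter_norm 0 t.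
Proof.
have h := @iter_norm_tri 0 0 (s ++ scale 0 t) (scale 0 s ++ t).
have e1 : iter_norm 0 (s ++ scale 0 t) = iter_norm 0 s.
  by rewrite scale0 -[_ ++ _]cats0 -catA iter_norm_zeros cats0.
have e2 : iter_norm 0 (scale 0 s ++ t) = iter_norm 0 t.
  by rewrite scale0 -[nseq _ _ ++ _]cat0s iter_norm_zeros.
have e3 (r : seq K) : add_seq r (scale 0 r) = r.
  by rewrite -{1}(scale1 r) add_seq_scale addr0 scale1.
have e4 (r : seq K) : add_seq (scale 0 r) r = r.
  by rewrite -{2}(scale1 r) add_seq_scale add0r scale1.
rewrite e1 e2 addr0 !size_cat !size_scale add_seq_cat ?size_scale // e3 e4 in h.
exact: h.
Qed.

(** P holds for u = sum_k s_k y_(n_k), for almost all n_0, then almost all n_1,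
    and so on. For fixed s these P form a proper filter on X, along which the
    norm of x + u tends to the iterated norm ([generic_iter_norm]). *)
Fixpoint generic (s : seq K) (P : X -> Prop) : Prop :=
  if s is c :: s' then U [set n | generic s' (fun u => P (c *: y n + u))] else P 0.

Lemma generic_mono s P Q : (forall u, P u -> Q u) -> generic s P -> generic s Q.
Proof.
elim: s P Q => [|c s ih] P Q PQ /=; first exact: PQ.
by apply: filterS => n /=; apply: ih => u; exact: PQ.
Qed.

Lemma generic_and s P Q : generic s P -> generic s Q -> generic s (fun u => P u /\ Q u).
Proof.
elim: s P Q => [|c s ih] P Q //= hP hQ.
by apply: filterS (filterI hP hQ) => n [/= h1 h2]; exact: ih.
Qed.

Lemma generic_true s : generic s (fun=> True).
Proof.
elim: s => //= c s ih; apply: (@filterS _ U _ setT); last exact: filterT.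
by move=> n _ /=.
Qed.

Lemma generic_ex s P : generic s P -> exists u, P u.
Proof.
elim: s P => [|c s ih] P /=; first by exists 0.
by move=> /filter_ex[n /ih[u Pu]]; exists (c *: y n + u).
Qed.

Lemma generic_all (I : eqType) (S : seq I) s (P : I -> X -> Prop) :
  (forall i, i \in S -> generic s (P i)) ->
  generic s (fun u => forall i, i \in S -> P i u).
Proof.
elim: S => [|i S ih] h; first by apply: generic_mono (generic_true s).
have h2 := ih (fun j jS => h j (mem_behead (s := i :: S) jS)).
apply: generic_mono (generic_and (h i (mem_head _ _)) h2) => u [Pi PS] j.
by rewrite inE => /orP[/eqP ->|/PS].
Qed.

Lemma generic_iter_norm s x b t e : 0 < e ->
  generic s (fun u => `|iter_norm (x + b *: u) t - iter_norm x (scale b s ++ t)| <= e).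
Proof.
elim: s x e => [|c s ih] x e e0 /=.
  by rewrite scaler0 addr0 subrr normr0 ltW.
have e2 : 0 < e / 2 by rewrite divr_gt0.
apply: filterS (ulimP (iter_norm_step_bd x (b * c) (scale b s ++ t)) e2) => n /= hn.
apply: generic_mono (ih (x + (b * c) *: y n) (e / 2) e2) => u hu.
rewrite scalerDr scalerA addrA.
apply: le_trans (ler_distD (iter_norm (x + (b * c) *: y n) (scale b s ++ t)) _ _) _.
by rewrite [leRHS](splitr e); exact: lerD.
Qed.

End VirtualNorm.

(** * The iterated norm and the spreading model *)

Section Combinations.
Context {R : realType} {cplx : bool}.
Local Notation K := (scalars R cplx).
Context {V : lmodType K}.

Fixpoint lincomb (f : nat -> V) (s : seq K) : V :=
  if s is c :: s' then c *: f 0 + lincomb (fun i => f i.+1) s' else 0.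

Lemma lincombE f s : lincomb f s = \sum_(i < size s) s`_i *: f i.
Proof.
elim: s f => [|c s ih] f /=; first by rewrite big_ord0.
by rewrite big_ord_recl ih.
Qed.

Lemma lincomb_cat f s t :
  lincomb f (s ++ t) = lincomb f s + lincomb (fun i => f (size s + i)%N) t.
Proof.
elim: s f => [|c s ih] f /=; first by rewrite add0r.
by rewrite ih addrA.
Qed.

Lemma lincomb_scale f a s : lincomb f (scale a s) = a *: lincomb f s.
Proof.
elim: s f => [|c s ih] f /=; first by rewrite scaler0.
by rewrite ih scalerDr scalerA.
Qed.

Lemma lincomb_nseq0 f n : lincomb f (nseq n 0) = 0.
Proof. by elim: n f => //= n ih f; rewrite ih scale0r addr0. Qed.

Lemma lincomb_flatten f (L s : seq K) :
  lincomb f (flatten [seq scale a L | a <- s]) =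
  \sum_(n < size s) s`_n *: \sum_(k < size L) L`_k *: f (n * size L + k)%N.
Proof.
elim: s f => [|a s ih] f /=; first by rewrite big_ord0.
rewrite lincomb_cat lincomb_scale ih big_ord_recl /= lincombE size_scale; congr (_ + _).
apply: eq_bigr => n _; congr (_ *: _); apply: eq_bigr => k _; congr (_ *: f _).
by rewrite /bump /= mulSn addnA.
Qed.

End Combinations.

Section PowerSum.
Context {R : realType} {cplx : bool} (p : R) (p1 : 1 <= p).
Local Notation K := (scalars R cplx).

Definition power_sum (s : seq K) : R := \sum_(b <- s) rnorm b `^ p.

Lemma power_sum_ge0 s : 0 <= power_sum s.
Proof. by apply: sumr_ge0 => b _; exact: powR_ge0. Qed.

Lemma power_sum_cat s t : power_sum (s ++ t) = power_sum s + power_sum t.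
Proof. exact: big_cat. Qed.

Lemma power_sum_nseq0 k : power_sum (nseq k 0) = 0.
Proof.
rewrite /power_sum big_nseq; elim: k => //= k ->.
by rewrite rnorm0 powR0 ?addr0 // gt_eqF // (lt_le_trans _ p1).
Qed.

Lemma power_sum_nth s : power_sum s = \sum_(i < size s) rnorm (s`_i) `^ p.
Proof. by rewrite /power_sum (big_nth 0) big_mkord. Qed.

End PowerSum.

Section Spreading.
Context {R : realType} {cplx : bool}.
Local Notation K := (scalars R cplx).
Context {X F : normedModType K} (y : nat -> X) (yt : nat -> F) (C : R).
Context (U : set_system nat) {UU : UltraFilter U}.
Hypothesis Uoo : forall M, U [set n | (M <= n)%N].
Hypothesis yC : forall n, rnorm (y n) <= C.
Hypothesis sm : spreading_model y yt.

Let pcomb (p : seq K) (ks : seq nat) := \sum_(i < size p) p`_i *: y (nth 0%N ks i).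

(** Along increasing indices beyond n the spreading model determines the norm up
    to eps n, and iterated limits can be taken along such indices only. Padding
    with zeros makes n as large as desired. *)
Lemma iter_norm_spread_unit s : (forall c, c \in s -> rnorm c <= 1) ->
  iter_norm y U 0 s = rnorm (lincomb yt s).
Proof.
move=> s1; have [_ _ [eps [_ eps0 heps]]] := sm.
apply/eqP; rewrite -subr_eq0 -normr_le0; apply/ler_addgt0Pl => e e0; rewrite addr0.
have /cvgrPdist_le/(_ _ e0)[M _ hM] := eps0.
set n := (maxn M (size s)); set s' := s ++ nseq (n.+1 - size s) 0.
have ns : (size s <= n)%N by rewrite leq_maxr.
have -> : iter_norm y U 0 s = iter_norm y U 0 s'.
  by rewrite /s' -[nseq _ _]cats0 iter_norm_zeros cats0.
have -> : lincomb yt s = lincomb yt s' by rewrite lincomb_cat lincomb_nseq0 addr0.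
have zs' : size s' = n.+1 by rewrite size_cat size_nseq subnKC // leqW.
have en : eps n <= e.
  by have := hM n (leq_maxl _ _); rewrite /= sub0r normrN => /(le_trans (ler_norm _)).
suff H : forall t p ks, p ++ t = s' -> size ks = size p -> sorted ltn ks ->
    all (leq n) ks -> `|iter_norm y U (pcomb p ks) t - rnorm (lincomb yt s')| <= e.
  by have := H s' [::] [::] erefl erefl erefl erefl; rewrite /pcomb big_ord0.
elim=> [|c t ih] p ks ps' sks oks nks /=.
  rewrite cats0 in ps'; rewrite /pcomb ps' lincombE zs'.
  have sk : size ks = n.+1 by rewrite sks ps'.
  move: (heps n (fun i => s'`_i) (fun i => nth 0%N ks i)) => h.
  apply: le_trans (ltW (h _ _ _)) en => [i||i j ij].
  - have : s'`_i \in s' by rewrite mem_nth // zs'.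
    rewrite mem_cat => /orP[/s1 //|]; rewrite mem_nseq => /andP[_ /eqP ->].
    by rewrite rnorm0.
  - by move/allP: nks; apply; rewrite mem_nth // sk.
  - apply: (@sorted_ltn_nth _ ltn ltn_trans) => //.
    + by rewrite inE sk.
    + by rewrite inE sk.
apply: (ulim_near (iter_norm_step_bd yC _ _ _)).
apply: filterS (filterI (Uoo n) (Uoo (last 0 ks).+1)) => k [/= nk lk].
have -> : pcomb p ks + c *: y k = pcomb (rcons p c) (rcons ks k).
  rewrite /pcomb size_rcons big_ord_recr /= !nth_rcons sks ltnn eqxx; congr (_ + _).
  by apply: eq_bigr => i _; rewrite !nth_rcons sks ltn_ord.
apply: ih.
- by rewrite cat_rcons.
- by rewrite !size_rcons sks.
- case: ks oks lk {sks nks} => //= a ks oks lk.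
  by rewrite rcons_path oks.
- by rewrite all_rcons nk.
Qed.

(** The bound on the coefficients is removed by homogeneity. *)
Lemma iter_norm_spread s : iter_norm y U 0 s = rnorm (lincomb yt s).
Proof.
pose M := 1 + norm1 s.
have M0 : 0 < M by rewrite ltr_wpDr // norm1_ge0.
pose s' := scale (of_real cplx M^-1) s.
have -> : s = scale (of_real cplx M) s'.
  by rewrite scale_scale -of_realM divff ?gt_eqF // of_real1 scale1.
rewrite lincomb_scale rnormZ -[0](scaler0 _ (of_real cplx M)) (iter_norm_scale yC).
congr (_ * _).
apply: iter_norm_spread_unit => c /mapP[d ds ->].
rewrite rnormM rnorm_of_real ?invr_ge0 ?(ltW M0) // ler_pdivrMl // mulr1.
suff : rnorm d <= norm1 s by rewrite /M; lra.
rewrite /norm1 (big_rem _ ds) /= lerDl; apply: sumr_ge0 => b _; exact: rnorm_ge0.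
Qed.

Context (p : R).
Hypothesis p1 : 1 <= p.
Hypothesis kr : krivine_set yt p%:E.

(** The Krivine vectors are combinations of consecutive yt_i, hence consecutive
    virtual blocks. *)
Lemma krivine_list N : exists L : seq K, forall s : seq K, (size s <= N)%N ->
  2^-1 * power_sum p s `^ p^-1 <= iter_norm y U 0 (flatten [seq scale a L | a <- s])
    <= 2 * power_sum p s `^ p^-1.
Proof.
have [_ /(_ 1 N ltr01)[m [lam hl]]] := kr.
have zL : size [seq lam k | k <- enum 'I_m] = m by rewrite size_map size_enum_ord.
exists [seq lam k | k <- enum 'I_m] => s sN; move: zL.
set L := map _ _ => zL.
set s' := s ++ nseq (N - size s) 0.
have zs' : size s' = N by rewrite size_cat size_nseq subnKC.
have -> : iter_norm y U 0 (flatten [seq scale a L | a <- s]) =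
    iter_norm y U 0 (flatten [seq scale a L | a <- s']).
  rewrite map_cat flatten_cat.
  suff -> : flatten [seq scale a L | a <- nseq (N - size s) 0] =
      nseq ((N - size s) * size L) 0 by rewrite -[nseq _ _]cats0 iter_norm_zeros cats0.
  elim: (N - size s)%N => //= k ->.
  by rewrite scale0 -nseqD mulSn.
have -> : power_sum p s = power_sum p s'.
  by rewrite power_sum_cat power_sum_nseq0 // addr0.
rewrite iter_norm_spread lincomb_flatten power_sum_nth.
have := hl (fun n => s'`_n); rewrite /= -zs' zL (_ : 1 + 1 = 2) //.
suff -> : \sum_(n < size s') s'`_n *: (\sum_(k < m) lam k *: yt (n * m + k)%N) =
  \sum_(n < size s') s'`_n *: (\sum_(k < m) L`_k *: yt (n * m + k)%N) by [].
apply: eq_bigr => n _; congr (_ *: _); apply: eq_bigr => k _; congr (_ *: _).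
by rewrite (nth_map k) ?size_enum_ord // nth_ord_enum.
Qed.

(** Differences of two copies of the Krivine block still satisfy the lower l_p
    estimate, being copies with coefficients (b, - b), and they are droppable. *)
Lemma krivine_block N : exists V : seq K, [/\ droppable y U V,
  iter_norm y U 0 V <= 4 &
  forall c : seq K, (size c <= N)%N ->
    2^-1 * power_sum p c `^ p^-1 <= iter_norm y U 0 (flatten [seq scale b V | b <- c])].
Proof.
have p0 : 0 < p by apply: lt_le_trans p1.
have [L hL] := krivine_list (2 * N.+1).
exists (L ++ scale (-1) L); split; first exact: droppable_diff yC _.
  have /andP[_] := hL [:: 1; -1] (leq_mul2l 2 1 N.+1).
  rewrite /= cats0 scale1 => /le_trans; apply.
  rewrite /power_sum !big_cons big_nil rnormN rnorm1 powR1 addr0 (_ : 1 + 1 = 2) //.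
  have : (2 : R) `^ p^-1 <= 2 `^ 1.
    by apply: ler_powR; rewrite ?invf_le1 // ler1n.
  by rewrite powRr1 //; lra.
move=> c cN; pose s := flatten [seq [:: b; - b] | b <- c].
have zs : size s = (2 * size c)%N.
  by rewrite /s; elim: (c) => //= b c' ->; rewrite mulnS.
have -> : flatten [seq scale b (L ++ scale (-1) L) | b <- c] =
    flatten [seq scale a L | a <- s].
  rewrite /s; elim: (c) => //= b c' ->.
  by rewrite scale_cat scale_scale mulrN1 catA.
have /hL/andP[h _] : (size s <= 2 * N.+1)%N by rewrite zs leq_mul2l (leq_trans cN).
apply: le_trans h; rewrite ler_pM2l ?invr_gt0 //.
apply: ge0_ler_powR; rewrite ?nnegrE ?power_sum_ge0 ?invr_ge0 ?(ltW p0) //.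
rewrite /s; elim: (c) => //= b c' ih.
rewrite /power_sum !big_cons -!/(power_sum p _) lerD2l.
by apply: le_trans ih _; rewrite lerDr powR_ge0.
Qed.

End Spreading.

(** * Construction of the basic sequence *)

Lemma recursive_choice (T : Type) (P : nat -> (nat -> T) -> T -> Prop) :
  inhabited T ->
  (forall i z z' u, (forall l, (l < i)%N -> z l = z' l) -> P i z u -> P i z' u) ->
  (forall i z, exists u, P i z u) ->
  exists z : nat -> T, forall i, P i z (z i).
Proof.
move=> [t0] ext ex.
have [f hf] := choice (fun q : nat * (nat -> T) => ex q.1 q.2).
pose fix L n := if n is m.+1 then rcons (L m) (f (m, nth t0 (L m))) else [::].
have sL n : size (L n) = n by elim: n => //= n ih; rewrite size_rcons ih.
pose z n := f (n, nth t0 (L n)).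
have Lz n l : (l < n)%N -> nth t0 (L n) l = z l.
  elim: n => //= n ih ln; rewrite nth_rcons sL.
  case: ltnP => h; first exact: ih.
  by have -> : l = n; [lia|rewrite eqxx].
exists z => i; apply: (ext i (nth t0 (L i))); first by move=> l /Lz.
exact: (hf (i, nth t0 (L i))).
Qed.

Section Nets.
Context {R : realType} {cplx : bool}.
Local Notation K := (scalars R cplx).

Lemma vec_net (eta : R) (D : nat) : 0 < eta ->
  exists S : seq (seq K), forall a : seq K, size a = D ->
    (forall c, c \in a -> rnorm c <= 1) ->
    exists2 b, b \in S & size b = D /\ forall l, rnorm (a`_l - b`_l) <= eta.
Proof.
move=> e0; have [S0 hS0] := @disc_net R cplx eta e0.
elim: D => [|D [S hS]].
  exists [:: [::]] => a /size0nil -> _; exists [::]; rewrite ?mem_head //.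
  by split => // l; rewrite subrr rnorm0 ltW.
exists [seq c :: b | c <- S0, b <- S] => -[//|c a] /= [sa] ha.
have [c' cS hc] := hS0 c (ha _ (mem_head _ _)).
have [b bS [sb hb]] := hS a sa (fun d da => ha d (mem_behead (s := c :: a) da)).
exists (c' :: b); first by apply/allpairsP; exists (c', b).
by split; [rewrite /= sb|case].
Qed.

Lemma dist1_le (eta : R) (s t : seq K) : size s = size t ->
  (forall l, rnorm (s`_l - t`_l) <= eta) -> dist1 s t <= eta * (size s)%:R.
Proof.
elim: s t => [|c s ih] [|d t] //= => [_ _|[st] h].
  by rewrite /dist1 big_nil mulr0.
rewrite dist1_cons -natr1 mulrDr mulr1 addrC lerD ?(h 0%N) //.
by apply: ih => // l; exact: (h l.+1).
Qed.

End Nets.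

Section PartialSums.
Context {R : realType} {cplx : bool}.
Local Notation K := (scalars R cplx).

Definition psum (X : normedModType K) (a : nat -> K) (z : nat -> X) n :=
  \sum_(i < n) a i *: z i.

Lemma psumS (X : normedModType K) (z : nat -> X) a n :
  psum a z n.+1 = psum a z n + a n *: z n.
Proof. by rewrite /psum big_ord_recr. Qed.

Lemma psum_linear (X : normedModType K) (z : nat -> X) (k : K) a b n :
  psum (fun i => k * a i + b i) z n = k *: psum a z n + psum b z n.
Proof.
rewrite /psum scaler_sumr -big_split; apply: eq_bigr => i _.
by rewrite scalerDl scalerA.
Qed.

Lemma psum_sub (X : normedModType K) (z : nat -> X) a b n :
  psum (fun i => a i - b i) z n = psum a z n - psum b z n.
Proof. by rewrite /psum -sumrB; apply: eq_bigr => i _; rewrite scalerBl. Qed.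

Lemma psum_diff (X : normedModType K) (z : nat -> X) a n :
  psum a z n.+1 - psum a z n = a n *: z n.
Proof. by rewrite psumS [_ + _ *: _]addrC addrK. Qed.

Lemma psum_scale (X : normedModType K) (z : nat -> X) e a n :
  psum (fun l => e * a l) z n = e *: psum a z n.
Proof. by rewrite /psum scaler_sumr; apply: eq_bigr => i _; rewrite scalerA. Qed.

Lemma psum_delta (X : normedModType K) (z : nat -> X) i n : (i < n)%N ->
  psum (fun j => (j == i)%:R) z n = z i.
Proof.
move=> h; rewrite /psum (bigD1 (Ordinal h)) //= eqxx scale1r big1 ?addr0 // => j.
by rewrite -val_eqE /= => /negbTE ->; rewrite scale0r.
Qed.

Lemma psum_stop (X : normedModType K) (z : nat -> X) a n m : (n <= m)%N ->
  psum (fun i => if (i < n)%N then a i else 0) z m = psum a z n.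
Proof.
move=> nm; rewrite -(subnKC nm); elim: (m - n)%N => [|k ih].
  by rewrite addn0; apply: eq_bigr => i _; rewrite ltn_ord.
by rewrite addnS psumS ih ltnNge leq_addr /= scale0r addr0.
Qed.

End PartialSums.

Section Construction.
Context {R : realType} {cplx : bool}.
Local Notation K := (scalars R cplx).
Context {X : normedModType K} (y : nat -> X) (C : R).
Context (U : set_system nat) {UU : UltraFilter U}.
Hypothesis yC : forall n, rnorm (y n) <= C.
Context (V : nat -> seq K) (N : nat -> nat).

Local Notation iter_norm := (iter_norm y U).

Definition block_sum j (c : seq K) := flatten [seq scale b (V j) | b <- c].
(** The virtual version of z_i: one block from each level up to i. *)
Definition ideal_vector i := flatten [seq V j | j <- iota 0 i.+1].
Definition err (i : nat) : R := 2^-1 ^+ i.+2.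

(** The vector u can stand for the virtual version of z_i after any combination of
    its predecessors and before at most N j virtual blocks of a level j <= i. *)
Definition realizes i (z : nat -> X) (u : X) :=
  forall (a : nat -> K) b c j, (forall l, (l < i)%N -> rnorm (a l) <= 1) ->
    rnorm b <= 1 -> (forall d, d \in c -> rnorm d <= 1) ->
    (j <= i)%N -> (size c <= N j)%N ->
    `|iter_norm (psum a z i + b *: u) (block_sum j c) -
      iter_norm (psum a z i) (scale b (ideal_vector i) ++ block_sum j c)| <= err i.

Lemma d1C (c d : seq K) : size c = size d -> dist1 c d = dist1 d c.
Proof.
elim: c d => [|g t ih] [|g' t'] //= [/ih h].
by rewrite !dist1_cons h rnormBC.
Qed.

Lemma size_block_sum j c d : size c = size d ->
  size (block_sum j c) = size (block_sum j d).
Proof.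
rewrite /block_sum; elim: c d => [|b c ih] [|b' d] //= [/ih h].
by rewrite !size_cat !size_scale h.
Qed.

Lemma dist1_block_sum j c d : size c = size d ->
  dist1 (block_sum j c) (block_sum j d) = dist1 c d * norm1 (V j).
Proof.
elim: c d => [|b c ih] [|b' d] //= => [_|[h]].
  by rewrite /block_sum /dist1 /= big_nil mul0r.
rewrite /block_sum /= -!/(block_sum _ _) dist1_cat ?size_scale // dist1_scale ih //.
by rewrite dist1_cons mulrDl.
Qed.

(** For each single choice of coefficients almost every u works; the coefficients
    range over totally bounded sets and both sides are Lipschitz in them, so
    finitely many choices suffice. *)
Lemma realizes_ex i z : exists u, realizes i z u.
Proof.
have C0 : 0 <= C by apply: le_trans (yC 0); exact: rnorm_ge0.
pose s := ideal_vector i; pose B : R := `|iter_norm 0 s| + 1.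
pose Zm := \sum_(l < i) rnorm (z l).
pose L := \sum_(j < i.+1) (norm1 (V j) * (N j)%:R).
pose W := Zm + B + C * (norm1 s + L) + 1.
have Zm0 : 0 <= Zm by apply: sumr_ge0 => l _; exact: rnorm_ge0.
have L0 : 0 <= L by apply: sumr_ge0 => l _; rewrite mulr_ge0 ?norm1_ge0.
have W0 : 0 < W.
  have := mulr_ge0 C0 (addr_ge0 (norm1_ge0 s) L0).
  by have := normr_ge0 (iter_norm 0 s); rewrite /W /B; lra.
have e0 : 0 < err i by rewrite exprn_gt0.
pose eta := err i / (4 * W).
have eta0 : 0 < eta by rewrite divr_gt0 // mulr_gt0.
have etaW : eta * W = err i / 4 by rewrite /eta; field; rewrite gt_eqF.
have [S hS] := choice (fun D => @vec_net R cplx eta D eta0).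
have [S0 hS0] := @disc_net R cplx eta eta0.
pose xa (a : seq K) := psum (fun l => a`_l) z i.
(* The mesh of the nets has to be fixed before u is known; this a priori bound
   on u makes that possible. *)
have evB : generic y U s (fun u => rnorm u <= B).
  apply: generic_mono (generic_iter_norm yC s 0 1 [::] ltr01) => u /=.
  rewrite add0r scale1r cats0 scale1 ler_norml /B => /andP[_].
  by have := ler_norm (iter_norm 0 s); lra.
have B0 : 0 <= B by rewrite /B addr_ge0.
clearbody B.
have ev0 : generic y U s (fun u => forall j, j \in iota 0 i.+1 -> forall r,
    r \in iota 0 (N j).+1 -> forall a, a \in S i -> forall b, b \in S0 ->
    forall c, c \in S r ->
    `|iter_norm (xa a + b *: u) (block_sum j c) -
      iter_norm (xa a) (scale b s ++ block_sum j c)| <= err i / 2).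
  apply: generic_all => j _; apply: generic_all => r _; apply: generic_all => a _.
  apply: generic_all => b _; apply: generic_all => c _.
  by apply: generic_iter_norm yC _ _ _ _ _ _; lra.
have [u [uB hu]] := generic_ex (generic_and evB ev0).
exists u => a b c j ha hb hc ji cN.
have [a' a'S [sa' haa']] : exists2 a', a' \in S i & size a' = i /\
    forall l, rnorm ((mkseq a i)`_l - a'`_l) <= eta.
  apply: hS; first exact: size_mkseq.
  by move=> d /mapP[l]; rewrite mem_iota add0n => /= li ->; exact: ha.
have [b' b'S hbb'] := hS0 b hb.
have [c' c'S [sc' hcc']] := hS (size c) c erefl hc.
have hX : rnorm (psum a z i - xa a') <= eta * Zm.
  rewrite /xa /psum -sumrB; apply: le_trans (rnorm_sum _ _ _) _.
  rewrite mulr_sumr; apply: ler_sum => l _; rewrite -scalerBl rnormZ.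
  rewrite ler_wpM2r ?rnorm_ge0 //; have := haa' l.
  by rewrite nth_mkseq.
have hT : C * dist1 (block_sum j c) (block_sum j c') <= eta * (C * L).
  rewrite dist1_block_sum // [leRHS]mulrCA ler_wpM2l //.
  apply: (@le_trans _ _ ((eta * (size c)%:R) * norm1 (V j))).
    by rewrite ler_wpM2r ?norm1_ge0 // dist1_le.
  rewrite -mulrA ler_wpM2l ?(ltW eta0) //.
  rewrite /L (bigD1 (Ordinal (ji : (j < i.+1)%N))) //= mulrC.
  rewrite ler_wpDr ?ler_wpM2l ?norm1_ge0 ?ler_nat //.
  by apply: sumr_ge0 => l _; rewrite mulr_ge0 ?norm1_ge0.
have hT' : C * dist1 (block_sum j c') (block_sum j c) <= eta * (C * L).
  rewrite dist1_block_sum // d1C // -dist1_block_sum //.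
have hS1 : `|iter_norm (psum a z i + b *: u) (block_sum j c) -
    iter_norm (xa a' + b' *: u) (block_sum j c')| <= eta * W.
  have hu2 : rnorm (b - b') * rnorm u <= eta * B by rewrite ler_pM ?rnorm_ge0.
  have hn : rnorm ((psum a z i + b *: u) - (xa a' + b' *: u)) <= eta * Zm + eta * B.
    rewrite opprD addrACA -scalerBl; apply: le_trans (rnormD _ _) _.
    by rewrite rnormZ; lra.
  have st := size_block_sum j (esym sc'); have st' := esym st.
  have h1 := iter_norm_lip (UU := UU) yC (psum a z i + b *: u) (xa a' + b' *: u) st.
  have h2 := iter_norm_lip (UU := UU) yC (xa a' + b' *: u) (psum a z i + b *: u) st'.
  rewrite rnormBC in h2.
  have h3 : 0 <= eta * (C * norm1 s).
    by apply: mulr_ge0; [exact: ltW|apply: mulr_ge0 => //; exact: norm1_ge0].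
  rewrite /W !mulrDr mulr1 ler_norml.
  by lra.
have hS2 : `|iter_norm (psum a z i) (scale b s ++ block_sum j c) -
    iter_norm (xa a') (scale b' s ++ block_sum j c')| <= eta * W.
  have st : size (scale b s ++ block_sum j c) = size (scale b' s ++ block_sum j c').
    by rewrite !size_cat !size_scale (size_block_sum j (esym sc')).
  have st' := esym st.
  have h1 := iter_norm_lip (UU := UU) yC (psum a z i) (xa a') st.
  have h2 := iter_norm_lip (UU := UU) yC (xa a') (psum a z i) st'.
  rewrite rnormBC in h2.
  rewrite !dist1_cat ?size_scale // !dist1_scale in h1 h2.
  rewrite (rnormBC b') in h2.
  have h3 : 0 <= eta * B by apply: mulr_ge0 => //; exact: ltW.
  have h4 : C * (rnorm (b - b') * norm1 s) <= eta * (C * norm1 s).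
    by rewrite mulrCA ler_wpM2r // mulr_ge0 ?norm1_ge0.
  rewrite mulrDr in h1; rewrite mulrDr in h2.
  rewrite /W !mulrDr mulr1 ler_norml.
  by lra.
have := hu j _ (size c) _ a' a'S b' b'S c' c'S.
rewrite !mem_iota /= !add0n !ltnS => /(_ ji cN).
rewrite etaW in hS1 hS2; move: hS1 hS2; rewrite -/s !ler_norml; lra.
Qed.

Lemma realizing_sequence : exists z : nat -> X, forall i, realizes i z (z i).
Proof.
apply: recursive_choice; [by constructor; exact: 0| |exact: realizes_ex].
move=> i z z' u zz' h a b c j.
have -> : psum a z' i = psum a z i by apply: eq_bigr => l _; rewrite zz'.
exact: h.
Qed.

Context (z : nat -> X).
Hypothesis zr : forall i, realizes i z (z i).
Hypothesis Vdrop : forall j, droppable y U (V j).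
Hypothesis V0 : 8 <= iter_norm 0 (V 0).
Hypothesis Vle : forall j, iter_norm 0 (V j) <= 64 * 2^-1 ^+ j.

Lemma err_gt0 i : 0 < err i. Proof. by rewrite exprn_gt0. Qed.
Lemma err_le i : err i <= 4^-1.
Proof.
rewrite /err !exprS; have : (2^-1 : R) ^+ i <= 1 by rewrite exprn_ile1 //; lra.
by lra.
Qed.

(** Make z_i virtual, then drop all of its blocks. *)
Lemma drop_step (a : nat -> K) i c j : (forall l, (l <= i)%N -> rnorm (a l) <= 1) ->
  (forall d, d \in c -> rnorm d <= 1) -> (j <= i)%N -> (size c <= N j)%N ->
  iter_norm (psum a z i) (block_sum j c) <=
  iter_norm (psum a z i.+1) (block_sum j c) + err i.
Proof.
move=> ha hc ji cN; rewrite psumS.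
have := zr (fun l li => ha l (ltnW li)) (ha i (leqnn i)) hc ji cN.
have hd : droppable y U (ideal_vector i).
  by apply: droppable_flatten => v /mapP[k _ ->].
have := hd (a i) (psum a z i) [::] (block_sum j c); rewrite /= ler_norml; lra.
Qed.

(** Make z_i virtual, then drop all of its blocks except the one of level j. *)
Lemma keep_step (a : nat -> K) i c j : (forall l, (l <= i)%N -> rnorm (a l) <= 1) ->
  (forall d, d \in c -> rnorm d <= 1) -> (j <= i)%N -> (size c <= N j)%N ->
  iter_norm (psum a z i) (block_sum j (a i :: c)) <=
  iter_norm (psum a z i.+1) (block_sum j c) + err i.
Proof.
move=> ha hc ji cN; rewrite psumS.
have := zr (fun l li => ha l (ltnW li)) (ha i (leqnn i)) hc ji cN.
have hd (r : seq nat) : droppable y U (flatten [seq V k | k <- r]).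
  by apply: droppable_flatten => v /mapP[k _ ->].
have -> : ideal_vector i = flatten [seq V k | k <- iota 0 j] ++ V j ++
    flatten [seq V k | k <- iota j.+1 (i - j)].
  rewrite /ideal_vector (_ : i.+1 = j + (i - j).+1)%N; last by lia.
  by rewrite iotaD map_cat flatten_cat.
rewrite !scale_cat -!catA.
have h1 := hd (iota 0 j) (a i) (psum a z i) [::] (scale (a i) (V j) ++ block_sum j c).
have h2 := hd (iota j.+1 (i - j)) (a i) (psum a z i)
  (scale (a i) (flatten [seq V k | k <- iota 0 j]) ++ scale (a i) (V j))
  (block_sum j c).
rewrite -!catA /= in h1 h2; rewrite /block_sum /= -/(block_sum j c) ler_norml; lra.
Qed.

Lemma z_ge i : 7 <= rnorm (z i).
Proof.
pose a l : K := (l == i)%:R.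
have ha l : (l <= i)%N -> rnorm (a l) <= 1.
  by rewrite /a; case: eqP => _ _; rewrite ?rnorm1 ?rnorm0.
have a0 : psum a z i = 0 by apply: big1 => l _; rewrite /a ltn_eqF // scale0r.
have h : iter_norm (psum a z i) (block_sum 0 [:: a i]) <=
    iter_norm (psum a z i.+1) (block_sum 0 [::]) + err i.
  exact: keep_step.
rewrite psumS a0 /block_sum /= cats0 /a eqxx scale1 add0r scale1r in h.
by move: h; have := V0; have := err_le i; lra.
Qed.

Lemma z_le i : rnorm (z i) <= 129.
Proof.
have := @zr i (fun=> 0) 1 [::] 0.
have -> : psum (fun=> 0) z i = 0 by apply: big1 => l _; rewrite scale0r.
rewrite rnorm0 rnorm1 /block_sum /= cats0 add0r scale1r scale1.
move=> h; have {h} : `|rnorm (z i) - iter_norm 0 (ideal_vector i)| <= err i by apply: h.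
have hz k : iter_norm 0 (flatten [seq V j | j <- iota 0 k]) <= 128 - 128 * 2^-1 ^+ k.
  elim: k => [|k ih]; first by rewrite /= rnorm0 expr0; lra.
  rewrite -addn1 iotaD map_cat flatten_cat /= cats0 add0n.
  apply: le_trans (iter_norm_cat0 yC _ _) _; have := Vle k.
  by rewrite addn1 exprS; lra.
have := hz i.+1; have : (0 : R) <= 2^-1 ^+ i.+1 by rewrite exprn_ge0.
by have := err_le i; rewrite ler_norml /ideal_vector; lra.
Qed.

(** Mazur's argument. The approximation is only available for coefficients of size
    at most 1, so one normalizes by the norm t of the partial sum; coefficients
    are then small because the z_l have norm at least 7, and if the last one is
    not, the last term dominates the sum. *)
Lemma basis_step a n : (forall m, (m <= n)%N ->
    rnorm (psum a z m) <= 2 * rnorm (psum a z n)) ->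
  (1 - err n) * rnorm (psum a z n) <= rnorm (psum a z n.+1).
Proof.
move=> h; have e0 := err_gt0 n; have e1 := err_le n.
have := rnorm_ge0 (psum a z n); rewrite le_eqVlt => /orP[/eqP <-|t0].
  by rewrite mulr0 rnorm_ge0.
set t := rnorm _ in h t0 *.
have hl l : (l < n)%N -> rnorm (a l) <= t.
  move=> ln; have h1 := h l.+1 ln; have h2 := h l (ltnW ln).
  have : rnorm (a l *: z l) <= 4 * t.
    by rewrite -psum_diff; apply: le_trans (rnormB _ _) _; lra.
  by rewrite rnormZ; have := z_ge l; have := rnorm_ge0 (a l); nra.
have [hn|hn] := leP (rnorm (a n)) t; last first.
  have := rnorm_le_sub (a n *: z n) (psum a z n).
  rewrite [_ *: _ + _]addrC -psumS -/t rnormZ.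
  by have := z_ge n; nra.
have r0 : 0 <= t^-1 by rewrite invr_ge0 ltW.
have ha l : (l <= n)%N -> rnorm (of_real cplx t^-1 * a l) <= 1.
  rewrite rnormM rnorm_of_real // ler_pdivrMl // mulr1 leq_eqVlt.
  by move=> /orP[/eqP -> //|/hl].
pose a' l := of_real cplx t^-1 * a l.
have : iter_norm (psum a' z n) (block_sum 0 [::]) <=
    iter_norm (psum a' z n.+1) (block_sum 0 [::]) + err n.
  exact: drop_step.
rewrite /block_sum /= !psum_scale !rnormZ rnorm_of_real // -/t mulVf ?gt_eqF //.
by rewrite -lerBlDr ler_pdivlMl // mulrC.
Qed.

(** The errors err n are chosen so that the constants 2 - 2^-n propagate. *)
Lemma basis_constant a n m : (m <= n)%N ->
  rnorm (psum a z m) <= 2 * rnorm (psum a z n).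
Proof.
suff : (m <= n)%N -> rnorm (psum a z m) <= (2 - 2^-1 ^+ n) * rnorm (psum a z n).
  move=> h /h /le_trans; apply; rewrite ler_wpM2r ?rnorm_ge0 //.
  by rewrite gerDl oppr_le0 exprn_ge0.
elim: n m => [|n ih] m; first by rewrite leqn0 => /eqP ->; rewrite expr0; lra.
have hp : (0 : R) <= 2^-1 ^+ n by rewrite exprn_ge0.
have hq : (2^-1 : R) ^+ n <= 1 by rewrite exprn_ile1 //; lra.
rewrite leq_eqVlt => /orP[/eqP ->|].
  by have := rnorm_ge0 (psum a z n.+1); rewrite exprS; nra.
rewrite ltnS => mn; apply: le_trans (ih _ mn) _.
have : (1 - 2^-1 * (2^-1 * 2^-1 ^+ n)) * rnorm (psum a z n) <=
    rnorm (psum a z n.+1).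
  have := @basis_step a n; rewrite /err !exprS; apply => k kn.
  apply: le_trans (ih _ kn) _.
  by rewrite ler_wpM2r ?rnorm_ge0 //; lra.
rewrite [_ ^+ n.+1]exprS.
have := rnorm_ge0 (psum a z n); have := rnorm_ge0 (psum a z n.+1).
set s := rnorm _; set s' := rnorm (psum a z n); set h := _ ^+ n in hp hq * => s0 s0' hs.
apply: (@le_trans _ _ ((2 - 2^-1 * h) * ((1 - 2^-1 * (2^-1 * h)) * s'))).
  by rewrite mulrA ler_wpM2r //; nra.
by rewrite ler_wpM2l //; lra.
Qed.

Lemma coef_le1 a n : rnorm (psum a z n) <= 1 -> forall l, (l < n)%N -> rnorm (a l) <= 1.
Proof.
move=> h l ln; have h1 := basis_constant a ln; have h2 := basis_constant a (ltnW ln).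
have : rnorm (a l *: z l) <= 4.
  by rewrite -psum_diff; apply: le_trans (rnormB _ _) _; lra.
by rewrite rnormZ; have := z_ge l; have := rnorm_ge0 (a l); nra.
Qed.

(** The descent from m + k to m. The size hypothesis guarantees that each step
    meets at most N j virtual blocks, and the errors form a geometric series. *)
Lemma extract (a : nat -> K) (A : pred nat) j k m :
  (forall l, (l < m + k)%N -> rnorm (a l) <= 1) -> (j <= m)%N ->
  (size (seq.filter A (iota m k)) <= N j)%N ->
  iter_norm (psum a z m) (block_sum j (map a (seq.filter A (iota m k)))) <=
  rnorm (psum a z (m + k)) + 2^-1 ^+ m.+1.
Proof.
elim: k m => [|k ih] m ha jm sA.
  by rewrite /block_sum /= addn0 lerDl exprn_ge0.
have ha' l : (l < m.+1 + k)%N -> rnorm (a l) <= 1 by rewrite addSnnS => /ha.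
have ham l : (l <= m)%N -> rnorm (a l) <= 1.
  by move=> lm; apply: ha; rewrite addnS ltnS (leq_trans lm) // leq_addr.
have sA' : (size (seq.filter A (iota m.+1 k)) <= N j)%N.
  by apply: leq_trans sA; rewrite /=; case: ifP.
have hc d : d \in map a (seq.filter A (iota m.+1 k)) -> rnorm d <= 1.
  move=> /mapP[l]; rewrite mem_filter mem_iota => /andP[_ /andP[_ lk]] ->.
  exact: ha'.
have sz : (size (map a (seq.filter A (iota m.+1 k))) <= N j)%N by rewrite size_map.
have := ih m.+1 ha' (leqW jm) sA'; rewrite addSnnS.
rewrite [_ ^+ m.+2]exprS /=; case: ifP => _ /=.
  have := keep_step ham hc jm sz; rewrite /err [_ ^+ m.+2]exprS; lra.
have := drop_step ham hc jm sz; rewrite /err [_ ^+ m.+2]exprS; lra.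
Qed.

(** After the descent, the remaining partial sum up to j is removed by the
    triangle inequality, at the price of its norm, which is at most 2. *)
Lemma block_sum_bound (a : nat -> K) (A : pred nat) j n :
  rnorm (psum a z n) <= 1 -> (j <= n)%N ->
  (size (seq.filter A (iota j (n - j))) <= N j)%N ->
  iter_norm 0 (block_sum j (map a (seq.filter A (iota j (n - j))))) <= 4.
Proof.
move=> h jn sA.
have := @extract a A j (n - j) j _ (leqnn j) sA; rewrite subnKC //.
move=> /(_ (coef_le1 h)) h1.
have h2 := basis_constant a jn.
have := iter_norm_lip (UU := UU) yC 0 (psum a z j)
  (erefl (size (block_sum j (map a (seq.filter A (iota j (n - j))))))).
rewrite d1xx mulr0 addr0 sub0r rnormN.
have : (2^-1 : R) ^+ j.+1 <= 1 by rewrite exprn_ile1 //; lra.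
lra.
Qed.

End Construction.

(** * Bases from a norm inequality, and operators on their span *)

Section ConvergenceAlgebra.
Context {R : realType} {cplx : bool}.
Local Notation K := (scalars R cplx).

Lemma tends_to_const (V : normedZmodType K) (l : V) : tends_to (fun=> l) l.
Proof. by move=> e e0; exists 0%N => n _; rewrite subrr rnorm0 ltW. Qed.

Lemma tends_toD (V : normedZmodType K) (u v : nat -> V) l m :
  tends_to u l -> tends_to v m -> tends_to (fun n => u n + v n) (l + m).
Proof.
move=> ul vm e e0; have e2 : 0 < e / 2 by rewrite divr_gt0.
have [M1 h1] := ul _ e2; have [M2 h2] := vm _ e2.
exists (maxn M1 M2) => n; rewrite geq_max => /andP[/h1 + /h2].
have := rnormD (u n - l) (v n - m); rewrite addrACA -opprD; lra.
Qed.

Lemma tends_toZl (X : normedModType K) (u : nat -> K) l (x : X) :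
  tends_to u l -> tends_to (fun n => u n *: x) (l *: x).
Proof.
move=> ul e e0.
have x0 : 0 < rnorm x + 1 by rewrite ltr_wpDl // rnorm_ge0.
have e1 : 0 < e / (rnorm x + 1) by rewrite divr_gt0.
have [M h] := ul _ e1; exists M => n /h; rewrite -scalerBl rnormZ.
rewrite ler_pdivlMr // => h1.
by have := rnorm_ge0 (u n - l); nra.
Qed.

Lemma tends_toZr (X : normedModType K) (a : K) (u : nat -> X) l :
  tends_to u l -> tends_to (fun n => a *: u n) (a *: l).
Proof.
move=> ul e e0.
have x0 : 0 < rnorm a + 1 by rewrite ltr_wpDl // rnorm_ge0.
have e1 : 0 < e / (rnorm a + 1) by rewrite divr_gt0.
have [M h] := ul _ e1; exists M => n /h; rewrite -scalerBr rnormZ.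
rewrite ler_pdivlMr // => h1.
by have := rnorm_ge0 (u n - l); nra.
Qed.

Lemma tends_to_eventually (V : normedZmodType K) (u : nat -> V) l M :
  (forall n, (M <= n)%N -> u n = l) -> tends_to u l.
Proof. by move=> h e e0; exists M => n /h ->; rewrite subrr rnorm0 ltW. Qed.

Lemma tends_to_rnorm_le (V : normedZmodType K) (u : nat -> V) l (c : R) :
  tends_to u l -> (exists M, forall n, (M <= n)%N -> rnorm (u n) <= c) -> rnorm l <= c.
Proof.
move=> ul [M h]; apply/ler_addgt0Pl => e /ul[M' h'].
have := h' _ (leq_maxr M M'); have := h _ (leq_maxl M M').
have := rnormD (u (maxn M M')) (l - u (maxn M M')).
rewrite addrC subrK (rnormBC l); lra.
Qed.

Lemma tends_to_psum (X : normedModType K) (z : nat -> X) (b : nat -> nat -> K) a m :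
  (forall i, tends_to (fun r => b r i) (a i)) ->
  tends_to (fun r => psum (b r) z m) (psum a z m).
Proof.
move=> h; elim: m => [|m ih].
  by apply: (tends_to_eventually (M := 0%N)) => n _; rewrite /psum !big_ord0.
have -> : (fun r => psum (b r) z m.+1) = fun r => psum (b r) z m + b r m *: z m.
  by apply: funext => r; rewrite psumS.
by rewrite psumS; apply: tends_toD ih _; exact: tends_toZl.
Qed.

Lemma finite_spanP (X : normedModType K) (z : nat -> X) (v : X) :
  (exists (n : nat) (a : 'I_n -> K), v = \sum_(i < n) a i *: z i) <->
  exists n a, v = psum a z n.
Proof.
split=> [[n [a ->]]|[n [a ->]]]; last by exists n, (fun i => a i).
exists n, (fun i => if insub i is Some j then a j else 0).
by apply: eq_bigr => i _; rewrite valK.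
Qed.

Lemma closed_span_closed_subspace (X : normedModType K) (z : nat -> X) :
  closed_subspace (closed_span z).
Proof.
split; first exact: closed_closure.
  by apply: subset_closure; exists 0%N, (fun=> 0); rewrite big_ord0.
move=> k u v /closureP hu /closureP hv; apply/closureP => e e0.
have k0 : 0 < rnorm k + 1 by rewrite ltr_wpDl // rnorm_ge0.
have e1 : 0 < e / 2 / (rnorm k + 1) by rewrite !divr_gt0.
have e2 : 0 < e / 2 by rewrite divr_gt0.
have [u' /finite_spanP[n [a ua]] hu'] := hu _ e1.
have [v' /finite_spanP[m [b vb]] hv'] := hv _ e2.
exists (k *: u' + v'); last first.
  rewrite opprD addrACA -scalerBr; apply: le_trans (rnormD _ _) _.
  rewrite rnormZ; rewrite ler_pdivlMr // in hu'.
  by have := rnorm_ge0 (u - u'); nra.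
apply/finite_spanP; exists (maxn n m).
exists (fun i => k * (if (i < n)%N then a i else 0) + (if (i < m)%N then b i else 0)).
by rewrite psum_linear !psum_stop ?leq_maxl ?leq_maxr // ua vb.
Qed.

End ConvergenceAlgebra.

Section BasisCriterion.
Context {R : realType} {cplx : bool}.
Local Notation K := (scalars R cplx).
Context {X : completeNormedModType K} (z : nat -> X) (D c : R).
Hypothesis D0 : 0 <= D.
Hypothesis c0 : 0 < c.
Hypothesis zc : forall i, c <= rnorm (z i).
Hypothesis zD : forall a n m, (m <= n)%N ->
  rnorm (psum a z m) <= D * rnorm (psum a z n).

(** All partial sums of an expansion depend continuously on its sum; existence,
    uniqueness and continuity of the coefficients follow from this. *)
Lemma expansion_dist a b u v m : tends_to (psum a z) u -> tends_to (psum b z) v ->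
  rnorm (psum a z m - psum b z m) <= D * rnorm (u - v).
Proof.
move=> au bv; apply/ler_addgt0Pl => e e0.
have D1 : 0 < D + 1 by rewrite ltr_wpDl.
have e1 : 0 < e / 2 / (D + 1) by rewrite !divr_gt0.
have [M1 h1] := au _ e1; have [M2 h2] := bv _ e1.
pose n := maxn m (maxn M1 M2).
have mn : (m <= n)%N by rewrite leq_maxl.
have := h1 n; rewrite !leq_max leqnn !orbT => /(_ isT) {}h1.
have := h2 n; rewrite !leq_max leqnn !orbT => /(_ isT) {}h2.
have := zD (fun i => a i - b i) mn; rewrite !psum_sub => /le_trans; apply.
have h3 := rnorm_split u (psum a z n) (psum b z n).
have h4 := rnorm_split v u (psum b z n).
rewrite (rnormBC v) in h4.
rewrite ler_pdivlMr // in h1; rewrite ler_pdivlMr // in h2.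
have h5 : rnorm (psum a z n - psum b z n) <=
    rnorm (u - v) + (rnorm (psum a z n - u) + rnorm (psum b z n - v)).
  by lra.
apply: le_trans (ler_wpM2l D0 h5) _; rewrite !mulrDr.
by have := rnorm_ge0 (psum a z n - u); have := rnorm_ge0 (psum b z n - v); lra.
Qed.

Lemma coef_dist a b i B : (forall m, rnorm (psum a z m - psum b z m) <= B) ->
  rnorm (a i - b i) <= 2 * B / c.
Proof.
move=> h; rewrite ler_pdivlMr //.
apply: (@le_trans _ _ (rnorm ((a i - b i) *: z i))).
  by rewrite rnormZ ler_wpM2l ?rnorm_ge0.
have -> : (a i - b i) *: z i =
    (psum a z i.+1 - psum b z i.+1) - (psum a z i - psum b z i).
  by rewrite -!psum_sub psum_diff.
apply: le_trans (rnormB _ _) _.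
by have := h i; have := h i.+1; lra.
Qed.

Lemma expansion_unique a b v : tends_to (psum a z) v -> tends_to (psum b z) v -> a = b.
Proof.
move=> av bv; apply: funext => i; apply/eqP; rewrite -subr_eq0; apply/eqP.
apply: rnorm_eq0; apply/eqP; rewrite eq_le rnorm_ge0 andbT.
have := @coef_dist a b i 0; rewrite mulr0 mul0r; apply => m.
by have := expansion_dist m av bv; rewrite subrr rnorm0 mulr0.
Qed.

(** The coefficients of finite combinations converging to v are Cauchy, and their
    limits are the coefficients of v. *)
Lemma closed_spanP v : closed_span z v <-> exists a, tends_to (psum a z) v.
Proof.
split=> [/closureP hv|[a av]]; last first.
  apply/closureP => e /av[M h]; exists (psum a z M); last first.
    by rewrite rnormBC; exact: h.
  by exists M, (fun i => a i).
have hq q : exists u : nat * (nat -> K), rnorm (v - psum u.2 z u.1) <= 2^-1 ^+ q.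
  have [|u /finite_spanP[n [a ->]] h] := hv (2^-1 ^+ q); first by rewrite exprn_gt0.
  by exists (n, a).
have [w hw] := choice hq.
pose u q := psum (w q).2 z (w q).1.
pose b q i := if (i < (w q).1)%N then (w q).2 i else 0.
have bu q : tends_to (psum (b q) z) (u q).
  by apply: (tends_to_eventually (M := (w q).1)) => n; exact: psum_stop.
have uv (e : R) : 0 < e -> exists M, forall q, (M <= q)%N -> rnorm (v - u q) <= e.
  move=> e0; have [k hk] := half_pow_small (1 : R) e0; exists k => q kq.
  apply: le_trans (hw q) _; apply: le_trans hk; rewrite mul1r.
  by apply: ler_wiXn2l => //; lra.
have bc i : exists l, tends_to (fun q => b q i) l.
  apply: scalar_complete => e e0.
  have e1 : 0 < e * c / (4 * (D + 1)).
    by rewrite divr_gt0 ?mulr_gt0 // ltr_wpDl.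
  have [M hM] := uv _ e1; exists M => q r /hM hq' /hM hr'.
  apply: (@le_trans _ _ (2 * (D * rnorm (u q - u r)) / c)).
    by apply: coef_dist => m; exact: expansion_dist.
  rewrite ler_pdivrMr //.
  have := rnorm_split v (u q) (u r); rewrite (rnormBC (u q) v) => h5.
  have D1 : 0 < 4 * (D + 1) by rewrite mulr_gt0 // ltr_wpDl.
  rewrite !ler_pdivlMr // in hq' hr'.
  have h6 := ler_wpM2l (ltW (ltr0n R 2)) (ler_wpM2l D0 h5).
  apply: le_trans h6 _.
  by have := rnorm_ge0 (v - u q); have := rnorm_ge0 (v - u r); lra.
have [a ha] := choice bc; exists a.
(* Let r tend to infinity in the distance between the expansions r and q. *)
have key m q : rnorm (psum a z m - psum (b q) z m) <= D * rnorm (v - u q).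
  apply/ler_addgt0Pl => e e0.
  have D1 : 0 < D + 1 by rewrite ltr_wpDl.
  have [M hM] := uv (e / (D + 1)) (divr_gt0 e0 D1).
  apply: (@tends_to_rnorm_le _ _ _ (fun r => psum (b r) z m - psum (b q) z m)).
    have h1 : tends_to (fun r => psum (b r) z m) (psum a z m).
      exact: (@tends_to_psum R cplx X z b a m ha).
    exact: (tends_toD h1 (tends_to_const (- psum (b q) z m))).
  exists M => r /hM; rewrite ler_pdivlMr // => hr.
  apply: le_trans (expansion_dist m (bu r) (bu q)) _.
  have := rnorm_split v (u r) (u q); rewrite (rnormBC (u r) v) => h5.
  apply: le_trans (ler_wpM2l D0 h5) _.
  by have := rnorm_ge0 (v - u r); lra.
move=> e e0; have D1 : 0 < D + 1 by rewrite ltr_wpDl.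
have [q hq'] := uv (e / (D + 1)) (divr_gt0 e0 D1).
have {}hq' := hq' q (leqnn q); rewrite ler_pdivlMr // in hq'.
exists (w q).1 => n qn.
have := key n q; rewrite (_ : psum (b q) z n = u q) ?psum_stop //.
have := rnorm_split (u q) (psum a z n) v; rewrite (rnormBC (u q)).
by lra.
Qed.

Lemma schauder_basis_closed_span : schauder_basis (closed_span z) z.
Proof.
have ps (a : nat -> K) : series (fun i => a i *: z i) = psum a z.
  by apply: funext => n; rewrite /series /= big_mkord.
split=> [i|v /closed_spanP[a av]].
  apply: subset_closure; exists i.+1, (fun j => (j == ord_max)%:R).
  rewrite big_ord_recr /= eqxx scale1r big1 ?add0r // => j _.
  by rewrite -val_eqE /= ltn_eqF ?scale0r.
exists a; rewrite /unique ps; split; first exact/tends_toP.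
by move=> b; rewrite ps => /tends_toP; exact: expansion_unique.
Qed.

Lemma operator_of_images (x : nat -> X) (M : R) : 0 <= M ->
  (forall a n, rnorm (psum a x n) <= M * rnorm (psum a z n)) ->
  exists T : X -> X, bounded_operator_on (closed_span z) T /\ forall i, T (z i) = x i.
Proof.
move=> M0 hM.
have ex v : exists l, closed_span z v ->
    exists a, tends_to (psum a z) v /\ tends_to (psum a x) l.
  have [/closed_spanP[a av]|nv] := pselect (closed_span z v); last by exists 0 => /nv.
  suff [l al] : exists l, tends_to (psum a x) l by exists l => _; exists a.
  apply: cauchy_tends_to => e e0.
  have M1 : 0 < M + 1 by rewrite ltr_wpDl.
  have [N hN] := av _ (divr_gt0 (divr_gt0 e0 (ltr0n _ 2)) M1).
  have main m n : (N <= m)%N -> (m <= n)%N -> rnorm (psum a x m - psum a x n) <= e.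
    move=> Nm mn; rewrite rnormBC.
    pose b i := a i - (if (i < m)%N then a i else 0).
    have e1 (t : nat -> X) : psum b t n = psum a t n - psum a t m.
      by rewrite psum_sub psum_stop.
    rewrite -e1; apply: le_trans (hM _ _) _; rewrite e1.
    have hm := hN m Nm; have hn := hN n (leq_trans Nm mn).
    have := rnorm_split v (psum a z n) (psum a z m); rewrite (rnormBC v) => h5.
    rewrite !ler_pdivlMr // in hm hn.
    apply: le_trans (ler_wpM2l M0 h5) _.
    by have := rnorm_ge0 (psum a z n - v); have := rnorm_ge0 (psum a z m - v); lra.
  exists N => m n Nm Nn; have [mn|nm] := leqP m n; first exact: main.
  by rewrite rnormBC; apply: main => //; exact: ltnW.
have [T hT] := choice ex; exists T.
have uT v a l : tends_to (psum a z) v -> tends_to (psum a x) l -> T v = l.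
  move=> av al.
  have [b [bv bl]] := hT v (proj2 (closed_spanP v) (ex_intro _ a av)).
  by rewrite (expansion_unique bv av) in bl; exact: tends_to_unique bl al.
split; last first.
  move=> i; apply: (uT _ (fun j => (j == i)%:R)).
    by apply: (tends_to_eventually (M := i.+1)) => n; exact: psum_delta.
  by apply: (tends_to_eventually (M := i.+1)) => n; exact: psum_delta.
split=> [k u v /hT[a [au aTu]] /hT[b [bv bTv]]|].
  apply: (uT _ (fun i => k * a i + b i)).
    have -> : psum (fun i => k * a i + b i) z = fun n => k *: psum a z n + psum b z n.
      by apply: funext => n; exact: psum_linear.
    by apply: tends_toD bv; exact: tends_toZr.
  have -> : psum (fun i => k * a i + b i) x = fun n => k *: psum a x n + psum b x n.
    by apply: funext => n; exact: psum_linear.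
  by apply: tends_toD bTv; exact: tends_toZr.
exists M => v /hT[a [av aTv]].
apply/ler_addgt0Pl => e e0.
have M1 : 0 < M + 1 by rewrite ltr_wpDl.
have [N hN] := av _ (divr_gt0 e0 M1).
apply: tends_to_rnorm_le aTv _; exists N => n /hN; rewrite ler_pdivlMr // => hn.
apply: le_trans (hM _ _) _.
have := rnormD (psum a z n - v) v; rewrite subrK => h5.
apply: le_trans (ler_wpM2l M0 h5) _.
by have := rnorm_ge0 (psum a z n - v); lra.
Qed.

End BasisCriterion.

Section Separated.
Context {R : realType} {cplx : bool}.
Local Notation K := (scalars R cplx).

(** A cluster point of q would have two distinct terms within d / 3 of it. *)
Lemma precompact_separated (X : normedModType K) (A : set X) (q : nat -> X)
    (d : R) (M : nat) : precompact A -> 0 < d -> (forall i, A (q i)) ->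
  (forall i j, (M <= i)%N -> (i < j)%N -> d <= rnorm (q i - q j)) -> False.
Proof.
rewrite precompactE => cA d0 Aq hd.
have [|x [_ hx]] := cA (q @ \oo) _.
  by exists 0%N => // n _; exact: subset_closure.
have d3 : 0 < of_real cplx (d / 3) by rewrite -(@of_real0 R cplx) of_real_lt divr_gt0.
have hit k : exists2 i, (k <= i)%N & rnorm (x - q i) < d / 3.
  have hk : (q @ \oo) (q @` [set i | (k <= i)%N]) by exists k => // i /= ki; exists i.
  have [_ [[i ki <-]]] := hx _ _ hk (nbhsx_ballx x _ d3).
  by rewrite -ball_normE /ball_ /= normE of_real_lt; exists i.
have [i Mi hi] := hit M; have [j ij hj] := hit i.+1.
have := hd i j Mi ij; have := rnorm_split x (q i) (q j).
rewrite (rnormBC (q i) x); lra.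
Qed.

End Separated.

(** * The upper estimate *)

Section Domination.
Context {R : realType} {cplx : bool}.
Local Notation K := (scalars R cplx).

Lemma sum_nth_widen (V : lmodType K) (f : nat -> V) (s : seq K) n : (size s <= n)%N ->
  \sum_(i < n) s`_i *: f i = \sum_(i < size s) s`_i *: f i.
Proof.
move=> sn; rewrite (big_ord_widen n (fun i => s`_i *: f i) sn) [RHS]big_mkcond /=.
apply: eq_bigr => i _; case: ltnP => // h.
by rewrite nth_default // scale0r.
Qed.

Lemma sc_dominates_small (E : normedModType K) (xt : nat -> E) (p : R) : 1 <= p ->
  sc_dominates (lp_norm p%:E) (seq_norm xt) -> forall eta : R, 0 < eta ->
  exists2 e : R, 0 < e & forall s : seq K, (forall c, c \in s -> rnorm c <= e) ->
    power_sum p s <= 1 -> rnorm (lincomb xt s) <= eta.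
Proof.
move=> p1 H eta eta0.
have p0 : 0 < p by apply: lt_le_trans p1.
have hn : nbhs (0%E : \bar R) [set t : \bar R | (t < eta%:E)%E].
  by apply: open_nbhs_nbhs; split; [exact: open_ereal_lt_ereal|rewrite /= lte_fin].
have h0 : \forall e \near (0:R)^'+, 0 < e by exact: nbhs_right_gt.
have h1 : \forall e \near (0:R)^'+,
    (sc_Delta (lp_norm p%:E) (@seq_norm R cplx E xt) e < eta%:E)%E := H _ hn.
have [e /= [he e0]] :=
  @filter_ex _ _ (at_right_proper_filter (0 : R)) _ (filterI h1 h0).
exists e; first by [].
move=> s hs sps; rewrite -lee_fin; apply: ltW; apply: le_lt_trans he.
apply: ereal_sup_ubound; exists (size s), (fun i => s`_i); split.
- by move=> i; apply: hs; rewrite mem_nth.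
- have e1 : (1 : R) `^ p^-1 = 1 by rewrite powR1.
  rewrite /lp_norm -(power_sum_nth p s) -[leRHS]e1.
  by apply: ge0_ler_powR; rewrite ?nnegrE ?power_sum_ge0 ?invr_ge0 ?(ltW p0).
- by rewrite /seq_norm lincombE.
Qed.

(** The spreading model bound for fewer vectors than it allows, with the error
    term of the longer sums. *)
Lemma spread_upper (X E : normedModType K) (x : nat -> X) (xt : nat -> E) (n : nat)
    (eps : R) :
  (forall (a : 'I_n.+1 -> K) (k : 'I_n.+1 -> nat),
      (forall i, rnorm (a i) <= 1) ->
      (n <= k ord0)%N -> (forall i j : 'I_n.+1, (i < j)%N -> (k i < k j)%N) ->
      `| rnorm (\sum_i a i *: x (k i)) - rnorm (\sum_i a i *: xt i) | < eps) ->
  forall (a : nat -> K) (k : nat -> nat) (B : seq nat),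
    (size B <= n)%N -> {homo k : i j / (i < j)%N} -> sorted ltn B ->
    (forall i, i \in B -> rnorm (a i) <= 1) -> (forall i, i \in B -> (n <= k i)%N) ->
    rnorm (\sum_(i <- B) a i *: x (k i)) <= rnorm (lincomb xt (map a B)) + eps.
Proof.
move=> H a k B sB khom oB aB kB.
(* The spreading model handles exactly n + 1 vectors: pad with zero coefficients
   at positions beyond those of B. *)
pose Bd := (\max_(i <- B) k i)%N.
pose idx r := if (r < size B)%N then k (nth 0%N B r) else (Bd + n + r.+1)%N.
pose s := map a B.
have zs : size s = size B by rewrite size_map.
have h := H (fun i => s`_i) (fun i => idx i).
have {h} : `|rnorm (\sum_(i < n.+1) s`_i *: x (idx i)) -
    rnorm (\sum_(i < n.+1) s`_i *: xt i)| < eps.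
  apply: h => [i||i j ij].
  - have [iB|iB] := ltnP i (size B).
      by rewrite /s (nth_map 0%N) // aB // mem_nth.
    by rewrite nth_default ?zs // rnorm0.
  - rewrite /idx; case: ltnP => [h|_] /=; first by rewrite kB // mem_nth.
    by rewrite addnAC leq_addl.
  - rewrite /idx; case: (ltnP j (size B)) => [jB|jB].
      rewrite (ltn_trans ij jB); apply: khom.
      by apply: (@sorted_ltn_nth _ ltn ltn_trans) => //; rewrite inE (ltn_trans ij).
    case: (ltnP i (size B)) => iB; last by rewrite ltn_add2l ltnS.
    have : (k (nth 0%N B i) <= Bd)%N.
      rewrite /Bd (big_nth 0%N) big_mkord.
      exact: (@leq_bigmax _ (fun r : 'I_(size B) => k (nth 0%N B r)) (Ordinal iB)).
    by move=> h; rewrite addnS ltnS -addnA (leq_trans h) // leq_addr.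
rewrite (sum_nth_widen (fun i => x (idx i))) ?zs ?leqW //.
rewrite (sum_nth_widen xt) ?leqW ?zs // -zs -lincombE ltr_norml => /andP[_ h].
have -> : \sum_(i <- B) a i *: x (k i) = \sum_(i < size s) s`_i *: x (idx i).
  rewrite (big_nth 0%N) big_mkord zs; apply: eq_bigr => i _.
  by rewrite /s (nth_map 0%N) // /idx ltn_ord.
by rewrite -lerBlDl; apply: ltW.
Qed.

Lemma power_sum_scale (p r : R) (s : seq K) : 0 <= r ->
  power_sum p (scale (of_real cplx r) s) = r `^ p * power_sum p s.
Proof.
move=> r0; rewrite /power_sum big_map mulr_sumr; apply: eq_bigr => c _.
by rewrite rnormM rnorm_of_real // powRM // rnorm_ge0.
Qed.

Lemma power_sum_count (p r : R) (s : seq K) : 0 <= p -> 0 <= r ->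
  (forall c, c \in s -> r <= rnorm c) -> (size s)%:R * r `^ p <= power_sum p s.
Proof.
move=> p0 r0; elim: s => [|c s ih] h; first by rewrite mul0r power_sum_ge0.
rewrite /power_sum big_cons -/(power_sum p s) /= -natr1 mulrDl mul1r addrC lerD //.
  by apply: ge0_ler_powR; rewrite ?nnegrE ?rnorm_ge0 // h // mem_head.
by apply: ih => d ds; apply: h; rewrite inE ds orbT.
Qed.

End Domination.

Section UpperEstimate.
Context {R : realType} {cplx : bool}.
Local Notation K := (scalars R cplx).
Context {X E : normedModType K} (x z : nat -> X) (xt : nat -> E) (p Cx : R).
Context (delta eps : nat -> R) (N nn k : nat -> nat).
Hypothesis p1 : 1 <= p.
Hypothesis xC : forall i, rnorm (x i) <= Cx.
Hypothesis delta0 : delta 0%N = 1.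
Hypothesis delta_gt0 : forall j, 0 < delta j.
Hypothesis delta_le : forall j, j.+1%:R * delta j <= 2^-1 ^+ j.
Hypothesis delta_sc : forall j (s : seq K), (0 < j)%N ->
  (forall c, c \in s -> rnorm c <= delta j) -> power_sum p s <= 1 ->
  rnorm (lincomb xt s) <= (2^-1 ^+ j) ^+ 2.
Hypothesis N_large : forall j, (2 ^+ j) `^ p < (N j)%:R * delta j.+1 `^ p.
Hypothesis nnN : forall j, (N j <= nn j)%N.
Hypothesis eps_le : forall j, eps (nn j) <= 2^-1 ^+ j.
Hypothesis eps_sm : forall n (a : 'I_n.+1 -> K) (k : 'I_n.+1 -> nat),
  (forall i, rnorm (a i) <= 1) ->
  (n <= k ord0)%N -> (forall i j : 'I_n.+1, (i < j)%N -> (k i < k j)%N) ->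
  `| rnorm (\sum_i a i *: x (k i)) - rnorm (\sum_i a i *: xt i) | < eps n.
Hypothesis k_hom : {homo k : i j / (i < j)%N}.
Hypothesis k_large : forall i j, (j <= i)%N -> (nn j <= k i)%N.
Hypothesis z_unit : forall a n, rnorm (psum a z n) <= 1 ->
  forall l, (l < n)%N -> rnorm (a l) <= 1.
Hypothesis z_power_sum : forall a (A : pred nat) j n,
  rnorm (psum a z n) <= 1 -> (j <= n)%N ->
  (size (seq.filter A (iota j (n - j))) <= N j)%N ->
  power_sum p (map a (seq.filter A (iota j (n - j)))) <= (2 ^+ j) `^ p.

Let Cx0 : 0 <= Cx. Proof. exact: le_trans (rnorm_ge0 _) (xC 0). Qed.
Let p0 : 0 < p. Proof. exact: lt_le_trans p1. Qed.

(** Otherwise N j of these indices would violate the l_p bound. *)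
Lemma level_size a (A : pred nat) j n : rnorm (psum a z n) <= 1 -> (j <= n)%N ->
  (forall i, A i -> delta j.+1 < rnorm (a i)) ->
  (size (seq.filter A (iota j (n - j))) <= N j)%N.
Proof.
move=> h jn hA; rewrite leqNgt; apply/negP => sz.
set B := seq.filter A _ in sz.
have sB : subseq (take (N j) B) (iota j (n - j)).
  by apply: subseq_trans (filter_subseq A _); exact: take_subseq.
have /(subseq_uniqP (iota_uniq _ _)) eB := sB.
have st : size (take (N j) B) = N j by rewrite size_takel // ltnW.
have := @z_power_sum a (mem (take (N j) B)) j n h jn; rewrite -eB st leqnn => /(_ isT).
apply/negP; rewrite -ltNge; apply: lt_le_trans (N_large j) _.
rewrite -{1}st -(size_map a); apply: power_sum_count (ltW p0) (ltW (delta_gt0 _)) _.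
move=> c /mapP[i /mem_take + ->]; rewrite mem_filter => /andP[Ai _].
exact: ltW (hA _ Ai).
Qed.

(** Level 0 has at most N 0 terms of bounded norm. On a level j > 0, dividing by
    2^j brings the l_p norm below 1, and the gain 4^-j from s.c. domination
    more than makes up for it. *)
Lemma level_bound a (A : pred nat) j n : rnorm (psum a z n) <= 1 -> (j <= n)%N ->
  (forall i, A i -> delta j.+1 < rnorm (a i) <= delta j) ->
  rnorm (\sum_(i <- seq.filter A (iota j (n - j))) a i *: x (k i)) <=
  (if j == 0%N then (N 0)%:R * Cx else 0) + 2 * 2^-1 ^+ j.
Proof.
move=> h jn hA; set B := seq.filter A _.
have sB : (size B <= N j)%N by apply: (@level_size a A j n h jn) => i /hA /andP[].
have Bn i : i \in B -> [/\ A i, (j <= i)%N & (i < n)%N].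
  by rewrite mem_filter mem_iota => /andP[-> /andP[-> ]]; rewrite subnKC.
have a1 i : i \in B -> rnorm (a i) <= 1 by case/Bn => _ _ i_n; apply: (z_unit h i_n).
have hp : (0 : R) <= 2^-1 ^+ j by rewrite exprn_ge0.
case: eqP => [j0|/eqP j0].
  apply: le_trans (rnorm_sum _ _ _) _.
  apply: (@le_trans _ _ (\sum_(i <- B) Cx)).
    rewrite big_seq [leRHS]big_seq; apply: ler_sum => i iB.
    rewrite rnormZ -[leRHS]mul1r.
    by apply: ler_pM; rewrite ?rnorm_ge0 // a1.
  rewrite big_const_seq count_predT iter_addr_0 -[leLHS]mulr_natl.
  have : (size B)%:R * Cx <= (N 0)%:R * Cx by rewrite ler_wpM2r // ler_nat -j0.
  by lra.
rewrite add0r.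
have oB : sorted ltn B by apply: sorted_filter (iota_ltn_sorted _ _); exact: ltn_trans.
have kB i : i \in B -> (nn j <= k i)%N by case/Bn => _ ji _; exact: k_large.
have := spread_upper (@eps_sm (nn j)) (leq_trans sB (nnN j)) k_hom oB a1 kB.
move=> /le_trans; apply.
have r0 : (0 : R) <= 2^-1 ^+ j by rewrite exprn_ge0.
have r1 : (2^-1 : R) ^+ j <= 1 by rewrite exprn_ile1 //; lra.
have := @delta_sc j (scale (of_real cplx (2^-1 ^+ j)) (map a B)).
rewrite lt0n j0 lincomb_scale rnormZ rnorm_of_real // => /(_ isT) hc.
suff : 2^-1 ^+ j * rnorm (lincomb xt (map a B)) <= (2^-1 ^+ j) ^+ 2.
  rewrite expr2 ler_pM2l ?exprn_gt0 //; have := eps_le j; lra.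
apply: hc.
  move=> c /mapP[d /mapP[i iB ->] ->]; rewrite rnormM rnorm_of_real //.
  have [/hA/andP[_ hi] _ _] := Bn i iB.
  rewrite -[leRHS]mul1r; apply: ler_pM => //; exact: rnorm_ge0.
rewrite power_sum_scale //; have := z_power_sum h jn sB.
move=> /(ler_wpM2l (powR_ge0 (2^-1 ^+ j) p)) /le_trans; apply.
by rewrite -powRM // ?exprn_ge0 // -exprMn mulVf // expr1n powR1.
Qed.

(** Take the least j with delta (j+1) < |c|; it exists since delta tends to 0,
    and minimality gives the upper bound. *)
Lemma level_exists (c : K) : c != 0 -> rnorm c <= 1 ->
  exists j, delta j.+1 < rnorm c <= delta j.
Proof.
move=> /rnorm_gt0 c0 c1.
have ex : exists j, delta j.+1 < rnorm c.
  have c2 : 0 < rnorm c / 2 by rewrite divr_gt0.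
  have [m hm] := half_pow_small (1 : R) c2; exists m.
  have := delta_le m.+1; have := delta_gt0 m.+1; rewrite exprS.
  have : (0 : R) <= m.+1%:R by [].
  rewrite -(natr1 m.+1) mulrDl mul1r => h1 h2.
  have := mulr_ge0 h1 (ltW h2); lra.
case: (ex_minnP ex) => -[|j] hj jmin.
  by exists 0%N; rewrite hj delta0.
exists j.+1; rewrite hj /= leNgt; apply/negP => /jmin.
by rewrite ltnn.
Qed.

(** The images of the z_i; the zeros at odd indices serve to rule out nonzero
    multiples of the inclusion. *)
Definition image_seq i := if odd i then 0 else x (k i).

Lemma upper_estimate a n : rnorm (psum a z n) <= 1 ->
  rnorm (psum a image_seq n) <= (N 0)%:R * Cx + 2 * (Cx + 2).
Proof.
move=> h.
have exl i : exists j, (i < n)%N -> a i != 0 ->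
    delta j.+1 < rnorm (a i) <= delta j.
  have [i_n|] := ltnP i n; last by exists 0%N.
  have [->|a0] := eqVneq (a i) 0; first by exists 0%N.
  by have [j hj] := level_exists a0 (z_unit h i_n); exists j.
have [lev hlev] := choice exl.
pose J := (\max_(i < n) lev i).+1.
pose P j i := [&& ~~ odd i, lev i == j, a i != 0 & (i < n)%N].
have -> : psum a image_seq n =
    \sum_(j < J) \sum_(i <- iota 0 n | P j i) a i *: x (k i).
  rewrite /psum; under [RHS]eq_bigr do rewrite big_mkcond.
  have -> : iota 0 n = index_iota 0 n by rewrite /index_iota subn0.
  rewrite exchange_big /= big_mkord; apply: eq_bigr => i _.
  rewrite /image_seq; have li : (lev i < J)%N by rewrite ltnS (leq_bigmax i).
  rewrite (bigD1 (Ordinal li)) //= big1 ?addr0 => [|j jl]; last first.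
    move: jl; rewrite -val_eqE /= => /negbTE jl.
    by rewrite /P [lev i == _]eq_sym jl andbF.
  rewrite /P eqxx ltn_ord andbT /=; case: odd => /=; first by rewrite scaler0.
  by case: eqP => //= ->; rewrite scale0r.
(* The level j contributes at most [t j], a summable amount. *)
apply: le_trans (rnorm_sum _ _ _) _.
pose t (j : nat) : R := (if j == 0%N then (N 0)%:R * Cx else 0) + (Cx + 2) * 2^-1 ^+ j.
apply: (@le_trans _ _ (\sum_(j < J) t j)); last first.
  suff H m : \sum_(j < m) t j <= (N 0)%:R * Cx + (Cx + 2) * (2 - 2 * 2^-1 ^+ m).
    apply: le_trans (H J) _.
    have : (0 : R) <= 2^-1 ^+ J by rewrite exprn_ge0.
    by have := Cx0; nra.
  case: m => [|m]; first by rewrite big_ord0 expr0 mulr1 subrr mulr0 addr0 mulr_ge0.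
  elim: m => [|m ih].
    by rewrite big_ord1 /t /= expr0 expr1; lra.
  rewrite big_ord_recr /=; move: ih; rewrite /t /= [_ ^+ m.+2]exprS; lra.
apply: ler_sum => j _.
(* Below j the coefficients are merely small, from j on the l_p bound applies. *)
pose m := minn j n.
have -> : iota 0 n = iota 0 m ++ iota m (n - m).
  by rewrite -{1}(subnKC (geq_minr j n)) iotaD.
rewrite big_cat /=; apply: le_trans (rnormD _ _) _.
have hP i : P j i -> delta j.+1 < rnorm (a i) <= delta j.
  by case/and4P => _ /eqP <- ai i_n; exact: hlev.
have h1 : rnorm (\sum_(i <- iota 0 m | P j i) a i *: x (k i)) <= Cx * 2^-1 ^+ j.
  apply: le_trans (rnorm_sum _ _ _) _.
  apply: (@le_trans _ _ (\sum_(i <- iota 0 m) delta j * Cx)).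
    rewrite big_mkcond /=; apply: ler_sum => i _; case: ifP => [/hP/andP[_ hi]|_].
      by rewrite rnormZ; apply: ler_pM; rewrite ?rnorm_ge0.
    by rewrite mulr_ge0 // ltW.
  rewrite big_const_seq count_predT size_iota iter_addr_0 -[leLHS]mulr_natl mulrA.
  rewrite [leRHS]mulrC; apply: ler_wpM2r => //.
  apply: le_trans (delta_le j); rewrite ler_wpM2r ?(ltW (delta_gt0 _)) // ler_nat.
  by rewrite leqW // geq_minl.
have h2 : rnorm (\sum_(i <- iota m (n - m) | P j i) a i *: x (k i)) <=
    (if j == 0 :> nat then (N 0)%:R * Cx else 0) + 2 * 2^-1 ^+ j.
  have [jn|nj] := leqP j n.
    by rewrite /m (minn_idPl jn) -big_filter; exact: level_bound.
  rewrite /m (minn_idPr (ltnW nj)) subnn big_nil rnorm0.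
  apply: addr_ge0; first by case: ifP => // _; rewrite mulr_ge0.
  by apply: mulr_ge0 => //; rewrite exprn_ge0.
by apply: le_trans (lerD h1 h2) _; rewrite addrCA -mulrDl.
Qed.

Lemma upper_estimate_hom a n :
  rnorm (psum a image_seq n) <= ((N 0)%:R * Cx + 2 * (Cx + 2)) * rnorm (psum a z n).
Proof.
have scale_unit (e : R) : 0 < e -> rnorm (psum a z n) <= e ->
    rnorm (psum a image_seq n) <= ((N 0)%:R * Cx + 2 * (Cx + 2)) * e.
  move=> e0 he.
  have ei : 0 <= e^-1 by rewrite invr_ge0 ltW.
  have := @upper_estimate (fun l => of_real cplx e^-1 * a l) n.
  rewrite !psum_scale !rnormZ !rnorm_of_real // => H.
  rewrite -ler_pdivrMr // mulrC; apply: H.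
  by rewrite ler_pdivrMl // mulr1.
have M0 : 0 <= (N 0)%:R * Cx + 2 * (Cx + 2).
  by apply: addr_ge0; [exact: mulr_ge0|have := Cx0; lra].
have := rnorm_ge0 (psum a z n); rewrite le_eqVlt => /orP[/eqP z0|z0]; last first.
  exact: scale_unit.
rewrite -z0 mulr0; apply/ler_addgt0Pl => e e0; rewrite addr0.
have M1 : 0 < (N 0)%:R * Cx + 2 * (Cx + 2) + 1 by rewrite ltr_wpDl.
apply: le_trans (scale_unit (e / ((N 0)%:R * Cx + 2 * (Cx + 2) + 1)) _ _) _.
- by rewrite divr_gt0.
- by rewrite -z0; apply: divr_ge0; apply: ltW.
by rewrite mulrA ler_pdivrMr // mulrC ler_wpM2l ?(ltW e0) // lerDl.
Qed.

End UpperEstimate.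

(** * The non-compact operator *)

Section Separation.
Context {R : realType} {cplx : bool}.
Local Notation K := (scalars R cplx).

(** Otherwise that vector would have two expansions. *)
Lemma basic_sequence_neq (E : normedModType K) (xt : nat -> E) :
  basic_sequence xt -> xt 0%N <> xt 1%N.
Proof.
move=> [hY hb] e01; have [a [_ ha]] := hb _ (hY 0%N).
have del i : xt i = xt 0%N ->
    series (fun l => (l == i)%:R *: xt l) @ \oo --> xt 0%N.
  move=> <-; apply/tends_toP; apply: (tends_to_eventually (M := i.+1)) => n hn.
  by rewrite /series /= big_mkord; exact: psum_delta.
have h0 := ha _ (del 0%N erefl); have h1 := ha _ (del 1%N (esym e01)).
have : (fun l : nat => (l == 0%N)%:R : K) = (fun l => (l == 1%N)%:R) by rewrite -h0.
by move/(congr1 (@^~ 0%N)) => /eqP; rewrite oner_eq0.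
Qed.

Lemma spreading_model_separated (X E : normedModType K) (x : nat -> X) (xt : nat -> E) :
  spreading_model x xt -> exists d : R, exists2 M, 0 < d & forall i j,
    (M <= i)%N -> (i < j)%N -> d <= rnorm (x i - x j).
Proof.
move=> [_ bx [eps [_ eps0 heps]]].
have d0 : 0 < rnorm (xt 0%N - xt 1%N).
  by apply: rnorm_gt0; rewrite subr_eq0; apply/eqP; exact: basic_sequence_neq.
have d2 : 0 < rnorm (xt 0%N - xt 1%N) / 2 by rewrite divr_gt0.
have /cvgrPdist_le/(_ _ d2)[M0 _ hM] := eps0.
pose n := maxn M0 1.
exists (rnorm (xt 0%N - xt 1%N) / 2), n => // i j ni ij.
have en : eps n <= rnorm (xt 0%N - xt 1%N) / 2.
  by have := hM n (leq_maxl _ _); rewrite /= sub0r normrN => /(le_trans (ler_norm _)).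
pose s : seq K := [:: 1; -1].
pose k r := if r == 0%N then i else (j + r)%N.-1.
have ns : (size s <= n.+1)%N by rewrite ltnS leq_maxr.
have := heps n (fun r => s`_r) (fun r => k r) _ ni _.
rewrite (sum_nth_widen (fun r => x (k r)) ns) (sum_nth_widen xt ns).
rewrite !big_ord_recl !big_ord0 /= !scale1r !scaleN1r !addr0 /k /= addn1 /=.
rewrite ltr_norml => H.
have /andP[h _] : - eps n < rnorm (x i - x j) - rnorm (xt 0%N - xt 1%N) < eps n.
  apply: H => [r|r r'].
    case: r => -[|[|r]] hr /=; rewrite ?rnormN ?rnorm1 //.
    by rewrite nth_nil rnorm0.
  by case: r r' => [[|r] hr] [[|r'] hr'] //=; lia.
by lra.
Qed.

End Separation.

Theorem theorem0p8 (R : realType) (cplx : bool)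
    (X E F : completeNormedModType (scalars R cplx))
    (x y : nat -> X) (xt : nat -> E) (yt : nat -> F) (p : R) :
  seminormalized x -> basic_sequence x ->
  seminormalized y -> basic_sequence y ->
  1 <= p ->
  spreading_model x xt ->
  sc_dominates (lp_norm p%:E) (seq_norm xt) ->
  spreading_model y yt ->
  krivine_set yt p%:E ->
  exists (Y : set X) (e : nat -> X) (T : X -> X),
    [/\ closed_subspace Y, schauder_basis Y e, bounded_operator_on Y T &
     ~ exists lambda : scalars R cplx,
         compact_operator_on Y (fun v => T v - lambda *: v)].
Proof.
move=> [cx [Cx [_ hx]]] _ [cy [Cy [_ hy]]] _ p1 smx scx smy kry.
have p0 : 0 < p by apply: lt_le_trans p1.
have xC i : rnorm (x i) <= Cx by have /andP[] := hx i.
have yC i : rnorm (y i) <= Cy by have /andP[] := hy i.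
have [eps [_ eps0 heps]] : exists eps : nat -> R, [/\ True, eps @ \oo --> (0 : R) &
    forall n (a : 'I_n.+1 -> scalars R cplx) (k : 'I_n.+1 -> nat),
      (forall i, rnorm (a i) <= 1) ->
      (n <= k ord0)%N -> (forall i j : 'I_n.+1, (i < j)%N -> (k i < k j)%N) ->
      `| rnorm (\sum_i a i *: x (k i)) - rnorm (\sum_i a i *: xt i) | < eps n].
  by have [_ _ [eps [_ h1 h2]]] := smx; exists eps.
have [U [UU sU]] := @ultraFilterLemma nat \oo _.
have Uoo M : U [set n | (M <= n)%N] by apply: sU; exists M.
have he j : exists e : R, 0 < e /\ forall s : seq (scalars R cplx),
    (forall c, c \in s -> rnorm c <= e) -> power_sum p s <= 1 ->
    rnorm (lincomb xt s) <= (2^-1 ^+ j) ^+ 2.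
  have [|e e0 h] := sc_dominates_small p1 scx (eta := (2^-1 ^+ j) ^+ 2).
    by rewrite !exprn_gt0.
  by exists e.
have [e {}he] := choice he.
(* Level thresholds: small enough for s.c. domination and for sum_j j delta_j. *)
pose delta j : R := if j == 0%N then 1 else Num.min (e j) (2^-1 ^+ j / j.+1%:R).
have pow0 j : (0 : R) < 2^-1 ^+ j by rewrite exprn_gt0.
have delta_gt0 j : 0 < delta j.
  by rewrite /delta; case: eqP => // _; rewrite lt_min (he j).1 divr_gt0.
have delta_le j : j.+1%:R * delta j <= 2^-1 ^+ j.
  rewrite /delta; case: eqP => [->|_]; first by rewrite mulr1 expr0.
  by rewrite -ler_pdivlMl // mulrC ge_min lexx orbT.
have delta_sc j (s : seq (scalars R cplx)) : (0 < j)%N ->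
    (forall c, c \in s -> rnorm c <= delta j) -> power_sum p s <= 1 ->
    rnorm (lincomb xt s) <= (2^-1 ^+ j) ^+ 2.
  rewrite lt0n /delta => /negbTE -> hs; apply: (he j).2 => c /hs.
  by rewrite le_min => /andP[].
have hN j : exists Nj : nat, ((2 : R) ^+ j) `^ p < Nj%:R * delta j.+1 `^ p.
  have dp : 0 < delta j.+1 `^ p by rewrite powR_gt0.
  exists (Num.bound (((2 : R) ^+ j) `^ p / delta j.+1 `^ p)).
  by rewrite -ltr_pdivrMr // archi_boundP // divr_ge0 ?powR_ge0.
have [N {}hN] := choice hN.
have N0 : (0 < N 0)%N.
  rewrite lt0n; apply/negP => /eqP h; have := hN 0%N.
  by rewrite h mul0r ltNge powR_ge0.
have [W hW] := choice (fun j => krivine_block Uoo yC smy p1 kry (N j)).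
(* The factor 16 makes the norms of the z_i at least 7, so that the coefficients
   of a vector of norm at most 1 are at most 1. *)
pose w j : R := 16 * 2^-1 ^+ j.
have w0 j : 0 <= w j by rewrite mulr_ge0 // ltW.
pose V j := scale (of_real cplx (w j)) (W j).
have iter_norm_w j s : iter_norm y U 0 (scale (of_real cplx (w j)) s) =
    w j * iter_norm y U 0 s.
  by rewrite -{1}(scaler0 _ (of_real cplx (w j))) (iter_norm_scale yC) rnorm_of_real.
have Vdrop j : droppable y U (V j).
  by apply: droppable_scale; have [] := hW j.
have V_low j c : (size c <= N j)%N ->
    8 * 2^-1 ^+ j * power_sum p c `^ p^-1 <= iter_norm y U 0 (block_sum V j c).
  move=> cN; have [_ _ /(_ c cN)] := hW j.
  have -> : block_sum V j c =
      scale (of_real cplx (w j)) (flatten [seq scale b (W j) | b <- c]).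
    rewrite /block_sum /V; elim: (c) => //= b c' ->.
    by rewrite scale_cat !scale_scale mulrC.
  by rewrite iter_norm_w => /(ler_wpM2l (w0 j)); rewrite /w; lra.
have V0 : 8 <= iter_norm y U 0 (V 0%N).
  have := @V_low 0%N [:: 1] N0; rewrite /block_sum /= cats0 scale1 expr0 !mulr1.
  by rewrite /power_sum big_seq1 rnorm1 !powR1 mulr1.
have Vle j : iter_norm y U 0 (V j) <= 64 * 2^-1 ^+ j.
  rewrite iter_norm_w; have [_ h _] := hW j.
  by have := ler_wpM2l (w0 j) h; rewrite /w; lra.
have [z zr] := realizing_sequence yC V N.
have z7 i := z_ge zr Vdrop V0 i.
have z129 i : rnorm (z i) <= 129 by exact: (z_le yC zr Vle).
have zbas a n m mn := @basis_constant _ _ _ _ _ _ _ _ zr Vdrop V0 a n m mn.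
have hnn j : exists n, (N j <= n)%N /\ eps n <= 2^-1 ^+ j.
  have /cvgrPdist_le/(_ _ (pow0 j))[M _ hM] := eps0.
  exists (maxn M (N j)); split; first exact: leq_maxr.
  have := hM _ (leq_maxl M (N j)).
  by rewrite /= sub0r normrN => /(le_trans (ler_norm _)).
have [nn {}hnn] := choice hnn.
(* Increasing, and beyond nn j as soon as i >= j. *)
pose k i := (\sum_(j < i.+1) (nn j).+1)%N.
have k_hom : {homo k : i j / (i < j)%N}.
  apply: homo_ltn => [|i]; first exact: ltn_trans.
  by rewrite /k [ltnRHS]big_ord_recr /= -[ltnLHS]addn0 ltn_add2l.
have k_large i j : (j <= i)%N -> (nn j <= k i)%N.
  rewrite -ltnS => ji; rewrite /k (bigD1 (Ordinal ji)) //= addSn.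
  by rewrite leqW // leq_addr.
have z_power_sum a (A : pred nat) j n : rnorm (psum a z n) <= 1 -> (j <= n)%N ->
    (size (seq.filter A (iota j (n - j))) <= N j)%N ->
    power_sum p (map a (seq.filter A (iota j (n - j)))) <= (2 ^+ j) `^ p.
  move=> h jn sA; set c := map a _.
  have hc : iter_norm y U 0 (block_sum V j c) <= 4.
    exact: (block_sum_bound yC zr Vdrop V0 h jn sA).
  have := le_trans (V_low j c _) hc; rewrite size_map => /(_ sA) {}hc.
  have h2 : power_sum p c `^ p^-1 <= 2 ^+ j.
    have h3 : 2 ^+ j * (2^-1 ^+ j * power_sum p c `^ p^-1) <= 2 ^+ j * 1.
      by rewrite ler_wpM2l ?exprn_ge0 //; lra.
    by rewrite mulrA -exprMn divff // expr1n mul1r mulr1 in h3.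
  have h4 : (power_sum p c `^ p^-1) `^ p <= (2 ^+ j) `^ p.
    by apply: ge0_ler_powR; rewrite ?nnegrE ?powR_ge0 ?exprn_ge0 // ltW.
  by rewrite -powRrM mulVf ?gt_eqF // powRr1 ?power_sum_ge0 // in h4.
have z_unit a n (h : rnorm (psum a z n) <= 1) := coef_le1 zr Vdrop V0 h.
have hM a n := upper_estimate_hom p1 xC erefl delta_gt0 delta_le delta_sc hN
  (fun j => (hnn j).1) (fun j => (hnn j).2) heps k_hom k_large z_unit z_power_sum a n.
have Cx0 : 0 <= Cx by apply: le_trans (xC 0%N); exact: rnorm_ge0.
have M0 : 0 <= (N 0%N)%:R * Cx + 2 * (Cx + 2).
  by apply: addr_ge0; [exact: mulr_ge0|lra].
have [T [bT Tz]] := operator_of_images (ler0n R 2) (ltr0n R 7) z7 zbas M0 hM.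
have subY := closed_span_closed_subspace z.
have basY := schauder_basis_closed_span (ler0n R 2) (ltr0n R 7) z7 zbas.
exists (closed_span z), z, T; split => // -[lambda].
rewrite /compact_operator_on; set A := (X in precompact X) => cA.
(* Scales all z_i into the unit ball. *)
pose b := of_real cplx (129^-1 : R).
have rb : rnorm b = 129^-1 by rewrite rnorm_of_real.
have Yz i : closed_span z (z i) by case: basY.
have T0 : T 0 = 0.
  case: bT => _ [C /(_ 0 (let: And3 _ h _ := subY in h))].
  rewrite rnorm0 mulr0 => h; apply: rnorm_eq0; apply/eqP.
  by rewrite eq_le h rnorm_ge0.
have Aq i : A (b *: (image_seq x k i - lambda *: z i)).
  have [_ Y0 YL] := subY; exists (b *: z i).
    split; first by rewrite -[_ *: _]addr0; exact: YL.
    by rewrite rnormZ rb; have := z129 i; lra.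
  have := bT.1 b (z i) 0 (Yz i) Y0; rewrite T0 !addr0 Tz => ->.
  by rewrite scalerBr !scalerA [lambda * b]mulrC.
have zsep i j : (i < j)%N -> 7 / 2 <= rnorm (z i - z j).
  move=> ij; have := zbas (fun l => (l == i)%:R - (l == j)%:R) j.+1 i.+1 (ltnW ij).
  have ij' : (i < j.+1)%N by rewrite ltnS ltnW.
  rewrite !psum_sub (psum_delta _ (ltnSn i)) (psum_delta _ (ltnSn j)).
  rewrite (psum_delta _ ij').
  have -> : psum (fun l => (l == j)%:R) z i.+1 = 0.
    apply: big1 => l _; rewrite ltn_eqF ?scale0r //.
    exact: leq_trans (ltn_ord l) ij.
  rewrite subr0; have := z7 i; lra.
have [l0|/rnorm_gt0 l0] := eqVneq lambda 0; last first.
  apply: (@precompact_separated _ _ _ _ (fun i => b *: (image_seq x k i.*2.+1 -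
    lambda *: z i.*2.+1)) (129^-1 * (rnorm lambda * (7 / 2))) 0 cA).
  - by rewrite !mulr_gt0.
  - by [].
  move=> i j _ ij; rewrite /image_seq /= !odd_double /= -scalerBr rnormZ rb ler_pM2l //.
  rewrite !sub0r opprK addrC -scalerBr rnormZ ler_pM2l // rnormBC.
  by apply: zsep; rewrite ltnS ltn_double.
have [d [M d0 hd]] := spreading_model_separated smx.
apply: (@precompact_separated _ _ _ _ (fun i => b *: (image_seq x k i.*2 -
    lambda *: z i.*2)) (129^-1 * d) M cA).
- by rewrite mulr_gt0.
- by [].
move=> i j Mi ij; rewrite /image_seq !odd_double l0 !scale0r !subr0 -scalerBr.
rewrite rnormZ rb ler_pM2l //; apply: hd; last by apply: k_hom; rewrite ltn_double.
have k_ge n : (n <= k n)%N.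
  by elim: n => // n ih; apply: leq_ltn_trans ih (k_hom _ _ (ltnSn n)).
by apply: leq_trans (k_ge _); rewrite -addnn (leq_trans Mi) // leq_addr.
Qed.
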